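(* Let $n\in\mathbb{N}$, $0<p<1$ and $0\le \alpha_1<(1-p)^{1/(1-p)}$. Then (P) with initial value $\alpha_1$ has a unique solution $w_1:[0,\infty)\to\mathbb{R}$, and for every $\epsilon>0$ there exists $\delta>0$ such that for all $0\le\alpha_2<(1-p)^{1/(1-p)}$ with $|\alpha_1-\alpha_2|<\delta$ there exists a unique solution $w_2:[0,\infty)\to\mathbb{R}$ to (P) with initial value $\alpha_2$, and $$\max\{|w_1(\eta)-w_2(\eta)|,\ |w_1'(\eta)-w_2'(\eta)|\}<\epsilon\qquad\forall\,\eta\in[0,\infty).$$ Moreover, $(w_i(\eta),w_i'(\eta))\to(0,0)$ as $\eta\to\infty$ for $i=1,2$.
   Context: Let $H:\mathbb{R}\to\mathbb{R}$ be $H(w)=\frac{1}{1-p}w-w|w|^{p-1}$ for $w\neq0$, $H(0)=0$. For $\alpha\in[0,(1-p)^{1/(1-p)}]$, a solution to (P) with initial value $\alpha$ is a function $w\in C^2([0,\infty))\cap L^\infty([0,\infty))$ with $w(0)=\alpha$, $w'(0)=0$ and $$w''+\left(\frac{n-1}{\eta}+\frac{\eta}{2}\right)w'-H(w)=0\qquad\forall\,\eta\in(0,\infty).$$ *)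

(* Defs.v *)
From Stdlib Require Import Reals.
From Coquelicot Require Import Coquelicot.
Open Scope R_scope.

Definition H (p w : R) : R :=
  if Req_dec_T w 0 then 0
  else 1 / (1 - p) * w - w * Rpower (Rabs w) (p - 1).

Definition alpha_max (p : R) : R := Rpower (1 - p) (1 / (1 - p)).

(* A function on [0, oo) is the restriction to [nonneg] of a total function:
   derivatives and continuity are relative to [nonneg], hence one-sided at 0,
   and values at negative arguments are irrelevant. *)
Definition nonneg (x : R) : Prop := 0 <= x.

Definition deriv_nonneg (f df : R -> R) : Prop :=
  forall x : R, nonneg x -> D_in f df nonneg x.

Definition cont_nonneg (f : R -> R) : Prop :=
  forall x : R, nonneg x -> continue_in f nonneg x.

(* For a continuous function on [0, oo), membership in L^oo is boundedness. *)
Definition bounded_nonneg (f : R -> R) : Prop :=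
  exists M : R, forall x : R, nonneg x -> Rabs (f x) <= M.

(* [dw] is the derivative of [w] on [0, oo); it is determined there by [w]. *)
Definition is_solution (n : nat) (p alpha : R) (w dw : R -> R) : Prop :=
  exists ddw : R -> R,
    deriv_nonneg w dw /\ deriv_nonneg dw ddw /\ cont_nonneg ddw /\
    bounded_nonneg w /\
    w 0 = alpha /\ dw 0 = 0 /\
    forall eta : R, 0 < eta ->
      ddw eta + ((INR n - 1) / eta + eta / 2) * dw eta - H p (w eta) = 0.

Definition is_unique_solution (n : nat) (p alpha : R) (w dw : R -> R) : Prop :=
  is_solution n p alpha w dw /\
  forall v dv : R -> R, is_solution n p alpha v dv ->
    forall eta : R, nonneg eta -> v eta = w eta.

(* Main.v *)
(** Let E = w'^2/2 + V(w) with V' = -H. Along solutions E is nonincreasing, and V increases with |w|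
    on [0, alpha_max], so a solution starting below a < alpha_max stays in [-a, a] and H may be
    truncated there. H fails to be Lipschitz only at 0, with |H(w) - H(v)| <= k |w - v| for
    k = O(1 + |w|^(p-1)). As long as E >= e > 0, the function B |w|^(p-1) w w' + A t has derivative
    at least k for suitable A and B, so a Gronwall estimate holds with a bounded integrating factor,
    although k is singular at the zeros of w; once E < e both solutions are small. This one
    comparison, stated for approximate solutions and with |w|^(p-1) smoothed, gives uniqueness,
    continuous dependence on compact intervals, and the Cauchy property of Tonelli's delayed
    approximations, hence existence. Decay follows from the Lyapunov function
    A E + w^2/4 + w w'/t and the divergence of the integral of 1/t; it makes the dependence uniform
    on [0, oo). *)

Require Import Defs.
From Stdlib Require Import Reals Lra Lia.
From Coquelicot Require Import Coquelicot.
Open Scope R_scope.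

(** * The signed power and its smoothing *)

(** A solution may cross 0 repeatedly, so [k] has no pointwise bound along it; only its integral can
    be controlled. The reason is that a crossing with positive energy happens at nonzero speed and
    that |w|^(p-1) is integrable near 0 because p > 0. The product |w|^(p-1) w w' expresses this as
    a pointwise inequality: its derivative contains p |w|^(p-1) w'^2, so the zeros need neither be
    located nor counted. Since w |w|^(p-1) has infinite slope at 0, the power is smoothed at a scale
    [rho]. All constants are uniform in [rho], and smoothing costs an additive error of order rho^p,
    made small after the Gronwall constant is fixed; the defects of approximate solutions enter in
    the same way.

    The estimate is asymmetric: weight, energy bound and range are those of the first solution
    alone. The other singularity, the damping at t = 0, has the favourable sign: together with w'(0)
    = 0 it yields |w'| <= C t, so that (n-1) w'/t stays bounded. *)

Lemma nonincreasing_of_derive (F : R -> R) (a b : R) :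
  a <= b -> (forall t, a <= t <= b -> continuity_pt F t) ->
  (forall t, a < t < b -> exists l, is_derive F t l /\ l <= 0) -> F b <= F a.
Proof.
  intros Hab Hc Hd.
  (* The intermediate point may be an endpoint, where nothing is known about the derivative of [F];
     the value 0 put there has the required sign. *)
  destruct (MVT_gen F a b
    (fun t => if Rlt_dec a t then if Rlt_dec t b then Derive F t else 0 else 0))
    as [c [_ Hc']].
  - rewrite Rmin_left, Rmax_right by assumption. intros t Ht.
    destruct (Rlt_dec a t), (Rlt_dec t b); try lra.
    destruct (Hd t Ht) as [l [Hl _]]. apply Derive_correct. now exists l.
  - rewrite Rmin_left, Rmax_right by assumption. exact Hc.
  - assert (Hneg : (if Rlt_dec a c then if Rlt_dec c b then Derive F c else 0 else 0) <= 0).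
    { destruct (Rlt_dec a c), (Rlt_dec c b); try lra.
      destruct (Hd c ltac:(lra)) as [l [Hl Hl0]]. now rewrite (is_derive_unique _ _ _ Hl). }
    cbv beta in Hc'. nra.
Qed.

Lemma Rpower_le_neg (x y c : R) : c <= 0 -> 0 < x <= y -> Rpower y c <= Rpower x c.
Proof.
  intros Hc Hx. assert (ln x <= ln y) by (apply ln_le; lra).
  destruct (Rle_lt_or_eq_dec (c * ln y) (c * ln x) ltac:(nra)) as [Hlt|Heq]; unfold Rpower.
  - left. now apply exp_increasing.
  - rewrite Heq. lra.
Qed.

Lemma mult_Rpower (x c : R) : 0 < x -> x * Rpower x (c - 1) = Rpower x c.
Proof.
  intros Hx. rewrite <- (Rpower_1 x Hx) at 1. rewrite <- Rpower_plus. f_equal; lra.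
Qed.

Definition signed_power (p w : R) : R :=
  if Req_dec_T w 0 then 0 else w * Rpower (Rabs w) (p - 1).

Lemma H_signed_power (p w : R) : H p w = / (1 - p) * w - signed_power p w.
Proof. unfold H, signed_power. destruct (Req_dec_T w 0); [subst|]; unfold Rdiv; ring. Qed.

Lemma signed_power_0 (p : R) : signed_power p 0 = 0.
Proof. unfold signed_power. destruct (Req_dec_T 0 0); lra. Qed.

Lemma signed_power_opp (p w : R) : signed_power p (- w) = - signed_power p w.
Proof.
  unfold signed_power. rewrite Rabs_Ropp.
  destruct (Req_dec_T w 0), (Req_dec_T (- w) 0); lra.
Qed.

Lemma signed_power_pos (p w : R) : 0 < w -> signed_power p w = w * Rpower w (p - 1).
Proof.
  intros Hw. unfold signed_power. destruct (Req_dec_T w 0); [lra|].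
  now rewrite Rabs_pos_eq by lra.
Qed.

(* [w^p - v^p <= (w - v) w^(p-1)] for [0 < v <= w], because [v^(p-1) >= w^(p-1)]. *)
Lemma signed_power_diff_le (p w v : R) : 0 < p < 1 -> 0 < w -> Rabs v <= w ->
  Rabs (signed_power p w - signed_power p v) <= 2 * (w - v) * Rpower w (p - 1).
Proof.
  intros Hp Hw Hv. rewrite (signed_power_pos p w Hw).
  assert (Hpw := exp_pos ((p - 1) * ln w)). fold (Rpower w (p - 1)) in Hpw.
  destruct (Rtotal_order v 0) as [Hv0|[->|Hv0]].
  - rewrite Rabs_left in Hv by assumption.
    replace (signed_power p v) with (- signed_power p (- v))
      by (rewrite signed_power_opp; lra).
    rewrite signed_power_pos by lra.
    assert (- v * Rpower (- v) (p - 1) <= w * Rpower w (p - 1)).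
    { rewrite !mult_Rpower by lra. apply Rle_Rpower_l; lra. }
    assert (Hpv := exp_pos ((p - 1) * ln (- v))). fold (Rpower (- v) (p - 1)) in Hpv.
    rewrite Rabs_pos_eq; nra.
  - rewrite signed_power_0, Rabs_pos_eq; nra.
  - rewrite Rabs_pos_eq in Hv by lra. rewrite signed_power_pos by lra.
    assert (v * Rpower v (p - 1) <= w * Rpower w (p - 1)).
    { rewrite !mult_Rpower by lra. apply Rle_Rpower_l; lra. }
    assert (Rpower w (p - 1) <= Rpower v (p - 1)) by (apply Rpower_le_neg; lra).
    rewrite Rabs_pos_eq; nra.
Qed.

Lemma signed_power_diff_le_max (p w v : R) :
  0 < p < 1 -> 0 < Rmax (Rabs w) (Rabs v) ->
  Rabs (signed_power p w - signed_power p v)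
    <= 2 * Rabs (w - v) * Rpower (Rmax (Rabs w) (Rabs v)) (p - 1).
Proof.
  intros Hp.
  assert (Hmain : forall w v, Rabs v <= Rabs w -> 0 < Rabs w ->
    Rabs (signed_power p w - signed_power p v) <= 2 * Rabs (w - v) * Rpower (Rabs w) (p - 1)).
  { clear w v. intros w v Hle Hpos. destruct (Rle_dec 0 w) as [Hw|Hw].
    - rewrite (Rabs_pos_eq w) in * by lra.
      assert (Hv := Rle_abs v). rewrite (Rabs_pos_eq (w - v)) by lra.
      now apply signed_power_diff_le.
    - rewrite (Rabs_left w) in * by lra.
      assert (Hv := Rle_abs (- v)). rewrite Rabs_Ropp in Hv. rewrite (Rabs_left1 (w - v)) by lra.
      replace (signed_power p w - signed_power p v)
        with (- (signed_power p (- w) - signed_power p (- v)))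
        by (rewrite !signed_power_opp; ring).
      rewrite Rabs_Ropp. replace (- (w - v)) with (- w - - v) by ring.
      apply signed_power_diff_le; try assumption. now rewrite Rabs_Ropp. }
  unfold Rmax. destruct (Rle_dec (Rabs w) (Rabs v)); intros Hpos.
  - rewrite Rabs_minus_sym, (Rabs_minus_sym w). now apply Hmain.
  - apply Hmain; [lra|assumption].
Qed.

(* Smooth substitute for the singular weight [|w|^(p-1)]. *)
Definition weight (p rho w : R) : R := Rpower (w * w + rho * rho) ((p - 1) / 2).

Lemma weight_pos (p rho w : R) : 0 < weight p rho w.
Proof. apply exp_pos. Qed.

Lemma Rpower_sqr_half (x c : R) : 0 < x -> Rpower (x * x) (c / 2) = Rpower x c.
Proof. intros Hx. unfold Rpower. rewrite ln_mult by assumption. f_equal. field. Qed.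

Lemma weight_le (p rho w c : R) : 0 < p < 1 -> 0 < c -> c <= Rabs w ->
  weight p rho w <= Rpower c (p - 1).
Proof.
  intros Hp Hc Hw. unfold weight. rewrite <- (Rpower_sqr_half c) by assumption.
  apply Rpower_le_neg; [lra|].
  assert (Rabs w * Rabs w = w * w) by (rewrite <- Rabs_mult; apply Rabs_pos_eq; nra). nra.
Qed.

Lemma weight_le_rho (p rho w : R) : 0 < p < 1 -> 0 < rho ->
  weight p rho w <= Rpower rho (p - 1).
Proof.
  intros Hp Hr. unfold weight. rewrite <- (Rpower_sqr_half rho) by assumption.
  apply Rpower_le_neg; nra.
Qed.

(** The weight is taken at [w] alone, whatever [v] is. With m = max(|w|,|v|): if m >= rho, then w^2
    + rho^2 <= 2 m^2, so m^(p-1) is at most twice the weight; if m < rho, each power is at most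
    rho^p, which is the additive error. *)
Lemma signed_power_diff_weight (p rho w v : R) : 0 < p < 1 -> 0 < rho ->
  Rabs (signed_power p w - signed_power p v)
    <= 4 * Rabs (w - v) * weight p rho w + 2 * Rpower rho p.
Proof.
  intros Hp Hr.
  assert (Hmw := Rmax_l (Rabs w) (Rabs v)). assert (Hmv := Rmax_r (Rabs w) (Rabs v)).
  assert (Hdiff := signed_power_diff_le_max p w v Hp).
  set (m := Rmax (Rabs w) (Rabs v)) in *.
  assert (Hg := weight_pos p rho w). assert (Hz := Rabs_pos (w - v)).
  assert (Hrp := exp_pos (p * ln rho)). fold (Rpower rho p) in Hrp.
  assert (Haw := Rabs_pos w).
  assert (Hww : Rabs w * Rabs w = w * w) by (rewrite <- Rabs_mult; apply Rabs_pos_eq; nra).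
  destruct (Rle_dec rho m) as [Hm|Hm].
  - assert (Hmg : Rpower m (p - 1) <= 2 * weight p rho w).
    { rewrite <- Rpower_sqr_half by lra.
      apply Rle_trans with (2 * Rpower (2 * (m * m)) ((p - 1) / 2)).
      - rewrite <- (Rpower_mult_distr 2) by nra.
        assert (1 <= 2 * Rpower 2 ((p - 1) / 2)).
        { rewrite <- (Rpower_1 2) at 1 by lra. rewrite <- Rpower_plus.
          rewrite <- (Rpower_O 2) at 1 by lra. apply Rle_Rpower; lra. }
        assert (Hq := exp_pos ((p - 1) / 2 * ln (m * m))).
        fold (Rpower (m * m) ((p - 1) / 2)) in Hq. nra.
      - apply Rmult_le_compat_l; [lra|]. apply Rpower_le_neg; nra. }
    specialize (Hdiff ltac:(lra)). nra.
  - assert (Hsp : forall u, Rabs u <= m -> Rabs (signed_power p u) <= Rpower rho p).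
    { intros u Hu. unfold signed_power. destruct (Req_dec_T u 0) as [|Hu0].
      - rewrite Rabs_R0. lra.
      - rewrite Rabs_mult, (Rabs_pos_eq (Rpower _ _)) by (left; apply exp_pos).
        assert (Hu' := Rabs_pos_lt u Hu0).
        rewrite mult_Rpower by assumption. apply Rle_Rpower_l; lra. }
    assert (Hw := Hsp w Hmw). assert (Hv := Hsp v Hmv).
    apply Rabs_le_between in Hw. apply Rabs_le_between in Hv.
    assert (0 <= 4 * Rabs (w - v) * weight p rho w) by (apply Rmult_le_pos; lra).
    apply Rabs_le; lra.
Qed.

(** Differentiation multiplies the weight by 1 + (p-1) w^2/(w^2 + rho^2), and this factor is at
    least p. The smoothing thus keeps, uniformly in [rho], the lower bound given by the derivative p
    |w|^(p-1) of the signed power. *)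
Lemma smoothed_power_derive (p rho w : R) : 0 < p < 1 -> 0 < rho ->
  exists l, is_derive (fun x => x * weight p rho x) w l /\ p * weight p rho w <= l.
Proof.
  intros Hp Hr. unfold weight. set (x := w * w + rho * rho).
  assert (Hx : 0 < x) by (unfold x; nra).
  exists (Rpower x ((p - 1) / 2) * (1 + (p - 1) * (w * w / x))). split.
  - unfold Rpower. auto_derive; [exact Hx|].
    fold x. field. lra.
  - assert (Hg := exp_pos ((p - 1) / 2 * ln x)). fold (Rpower x ((p - 1) / 2)) in Hg.
    assert (w * w / x <= 1).
    { apply Rmult_le_reg_r with x; [assumption|]. unfold Rdiv.
      rewrite Rmult_assoc, Rinv_l by lra. unfold x; nra. }
    rewrite Rmult_comm. apply Rmult_le_compat_l; nra.
Qed.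

(** With x = w^2 + rho^2 the product is at most x^(1/2) x^((p-1)/2) = x^(p/2). The bound is free of
    [rho], although the weight itself blows up at w = 0 as [rho] tends to 0. *)
Lemma smoothed_power_bound (p rho w a : R) : 0 < p < 1 -> 0 < rho <= 1 -> Rabs w <= a ->
  Rabs (w * weight p rho w) <= a * a + 1.
Proof.
  intros Hp Hr Hw.
  assert (Haw := Rabs_pos w).
  assert (Hww : Rabs w * Rabs w = w * w) by (rewrite <- Rabs_mult; apply Rabs_pos_eq; nra).
  unfold weight. set (x := w * w + rho * rho).
  assert (Hx : 0 < x) by (unfold x; nra).
  rewrite Rabs_mult, (Rabs_pos_eq (Rpower _ _)) by (left; apply exp_pos).
  apply Rle_trans with (Rpower x (/ 2) * Rpower x ((p - 1) / 2)).
  - apply Rmult_le_compat_r; [left; apply exp_pos|].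
    rewrite Rpower_sqrt by assumption. rewrite <- sqrt_Rsqr_abs.
    apply sqrt_le_1_alt. unfold Rsqr, x. nra.
  - rewrite <- Rpower_plus. replace (/ 2 + (p - 1) / 2) with (p / 2) by field.
    assert (Hx1 : x <= a * a + 1) by (unfold x; nra).
    apply Rle_trans with (Rpower (a * a + 1) (p / 2)).
    + apply Rle_Rpower_l; lra.
    + rewrite <- (Rpower_1 (a * a + 1)) at 2 by nra. apply Rle_Rpower; nra.
Qed.

Lemma Rpower_small (p e : R) : 0 < p -> 0 < e -> exists rho, 0 < rho <= 1 /\ Rpower rho p <= e.
Proof.
  intros Hp He. exists (Rmin 1 (Rpower e (/ p))).
  assert (Hpos : 0 < Rpower e (/ p)) by apply exp_pos.
  split.
  - split; [now apply Rmin_glb_lt; [lra|]|apply Rmin_l].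
  - apply Rle_trans with (Rpower (Rpower e (/ p)) p).
    + apply Rle_Rpower_l; [lra|]. split; [now apply Rmin_glb_lt; [lra|]|apply Rmin_r].
    + rewrite Rpower_mult, Rinv_l, Rpower_1 by lra. lra.
Qed.

(** * Damped equations and energy *)

Lemma continuity_pt_add (f g : R -> R) (t : R) :
  continuity_pt f t -> continuity_pt g t -> continuity_pt (fun x => f x + g x) t.
Proof. exact (continuity_pt_plus f g t). Qed.

Lemma continuity_pt_sub (f g : R -> R) (t : R) :
  continuity_pt f t -> continuity_pt g t -> continuity_pt (fun x => f x - g x) t.
Proof. exact (continuity_pt_minus f g t). Qed.

Lemma continuity_pt_mul (f g : R -> R) (t : R) :
  continuity_pt f t -> continuity_pt g t -> continuity_pt (fun x => f x * g x) t.
Proof. exact (continuity_pt_mult f g t). Qed.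

Lemma continuity_pt_cst (c t : R) : continuity_pt (fun _ => c) t.
Proof. now apply continuity_pt_const. Qed.

Lemma continuity_pt_var (t : R) : continuity_pt (fun x => x) t.
Proof. exact (continuity_pt_id t). Qed.

Lemma continuity_pt_compose (f g : R -> R) (t : R) :
  continuity_pt f t -> continuity_pt g (f t) -> continuity_pt (fun x => g (f x)) t.
Proof. exact (continuity_pt_comp f g t). Qed.

Lemma is_derive_continuity_pt (f : R -> R) (t l : R) : is_derive f t l -> continuity_pt f t.
Proof. intros Hf. apply derivable_continuous_pt. exists l. now apply is_derive_Reals. Qed.

Ltac continuity_step :=
  match goal with
  | |- continuity_pt (fun _ => ?c) _ => apply continuity_pt_cst
  | |- continuity_pt (fun x => x) _ => apply continuity_pt_var
  | |- continuity_pt (fun x => @?f x + @?g x) _ => apply (continuity_pt_add f g)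
  | |- continuity_pt (fun x => @?f x - @?g x) _ => apply (continuity_pt_sub f g)
  | |- continuity_pt (fun x => @?f x * @?g x) _ => apply (continuity_pt_mul f g)
  | _ => assumption
  end.

(** * The damping coefficient and its integrating factor *)

Definition damping (n : nat) (t : R) : R := (INR n - 1) / t + t / 2.

Lemma INR_ge_1 (n : nat) : (1 <= n)%nat -> 1 <= INR n.
Proof. exact (le_INR 1 n). Qed.

Lemma damping_ge_half (n : nat) (t : R) : (1 <= n)%nat -> 0 < t -> t / 2 <= damping n t.
Proof.
  intros Hn Ht. apply INR_ge_1 in Hn. unfold damping.
  assert (0 <= (INR n - 1) / t) by (apply Rdiv_le_0_compat; lra). lra.
Qed.

(** The exponential of a primitive of the damping. With q for this factor, y' = g - [damping] y
    becomes (q y)' = q g, in which the pole at 0 has disappeared. *)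
Definition integrating_factor (n : nat) (t : R) : R := t ^ (n - 1) * exp (t * t / 4).

Lemma integrating_factor_pos (n : nat) (t : R) : 0 < t -> 0 < integrating_factor n t.
Proof. intros Ht. apply Rmult_lt_0_compat; [now apply pow_lt|apply exp_pos]. Qed.

Lemma integrating_factor_derive (n : nat) (t : R) : (1 <= n)%nat -> 0 < t ->
  is_derive (integrating_factor n) t (damping n t * integrating_factor n t).
Proof.
  intros Hn Ht. unfold integrating_factor, damping, Rdiv. auto_derive; [trivial|].
  destruct n as [|[|m]]; [lia| |].
  - simpl. field. lra.
  - replace (S (S m) - 1)%nat with (S m) by lia. rewrite !S_INR. simpl pow. simpl pred. field. lra.
Qed.

Lemma integrating_factor_continuity (n : nat) (t : R) : continuity_pt (integrating_factor n) t.
Proof.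
  eapply is_derive_continuity_pt. unfold integrating_factor. auto_derive; [trivial|reflexivity].
Qed.

(** The damping is nonnegative, so the line G t is a supersolution, and the integrating factor times
    y - G t is nonincreasing from the value 0. A bound linear in t is needed because it compensates
    the pole of the damping at 0. *)
Lemma damped_upper_bound (n : nat) (G T : R) (y : R -> R) :
  (1 <= n)%nat -> 0 <= G -> (forall t, continuity_pt y t) -> y 0 = 0 ->
  (forall t, 0 < t < T -> exists g, g <= G /\ is_derive y t (g - damping n t * y t)) ->
  forall t, 0 <= t <= T -> y t <= G * t.
Proof.
  intros Hn HG Hc Hy0 Hd t Ht.
  destruct (Rle_lt_or_eq_dec 0 t ltac:(lra)) as [Ht0|<-]; [|lra].
  assert (Hmono : integrating_factor n t * (y t - G * t)
                  <= integrating_factor n 0 * (y 0 - G * 0)).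
  { apply (nonincreasing_of_derive (fun s => integrating_factor n s * (y s - G * s))); [lra| |].
    - intros s _. repeat continuity_step; [apply integrating_factor_continuity|apply Hc].
    - intros s Hs. destruct (Hd s ltac:(lra)) as [g [Hg Hyd]].
      assert (Hq := integrating_factor_pos n s ltac:(lra)).
      assert (Hb := damping_ge_half n s Hn ltac:(lra)).
      exists (integrating_factor n s * (g - G - damping n s * (G * s))). split.
      + evar_last.
        { apply @is_derive_mult; [now apply integrating_factor_derive|
            |exact Rmult_comm].
          apply @is_derive_minus; [exact Hyd|auto_derive; [trivial|reflexivity]]. }
        unfold mult, plus, minus, opp; simpl; unfold mult, plus, minus, opp; simpl. ring.
      + assert (0 <= damping n s * (G * s)) by (repeat apply Rmult_le_pos; lra). nra. }
  rewrite Hy0 in Hmono.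
  assert (Hq := integrating_factor_pos n t Ht0). nra.
Qed.

Lemma damped_bound (n : nat) (G T : R) (y : R -> R) :
  (1 <= n)%nat -> 0 <= G -> (forall t, continuity_pt y t) -> y 0 = 0 ->
  (forall t, 0 < t < T -> exists g, Rabs g <= G /\ is_derive y t (g - damping n t * y t)) ->
  forall t, 0 <= t <= T -> Rabs (y t) <= G * t.
Proof.
  intros Hn HG Hc Hy0 Hd t Ht. apply Rabs_le. split.
  - enough (- y t <= G * t) by lra.
    apply (damped_upper_bound n G T (fun s => - y s)); try assumption.
    + intros s. apply (continuity_pt_opp y), Hc.
    + rewrite Hy0. ring.
    + intros s Hs. destruct (Hd s Hs) as [g [Hg Hyd]]. exists (- g). split.
      * apply Rabs_le_between in Hg. lra.
      * evar_last; [apply @is_derive_opp, Hyd|]. unfold opp; simpl. ring.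
  - apply (damped_upper_bound n G T y); try assumption.
    intros s Hs. destruct (Hd s Hs) as [g [Hg Hyd]]. exists g. split; [|assumption].
    apply Rabs_le_between in Hg. lra.
Qed.

(** * Potential and energy *)

Definition potential (h : R -> R) (w : R) : R := - RInt h 0 w.

Lemma potential_derive (h : R -> R) (w : R) :
  (forall x, continuity_pt h x) -> is_derive (potential h) w (- h w).
Proof.
  intros Hh. apply @is_derive_opp, is_derive_RInt with 0.
  - exists posreal_one. intros b _. apply @RInt_correct, ex_RInt_continuous.
    intros x _. apply continuity_pt_filterlim, Hh.
  - apply continuity_pt_filterlim, Hh.
Qed.

Lemma potential_0 (h : R -> R) : potential h 0 = 0.
Proof. unfold potential. rewrite RInt_point. apply Ropp_0. Qed.

Lemma potential_increasing (h : R -> R) (u v : R) :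
  (forall x, continuity_pt h x) -> u < v -> (forall x, u < x < v -> h x < 0) ->
  potential h u < potential h v.
Proof.
  intros Hh Huv Hneg.
  destruct (MVT_cor2 (potential h) (fun x => - h x) u v Huv) as [c [Hc Hc']].
  - intros x _. apply is_derive_Reals, potential_derive, Hh.
  - specialize (Hneg c Hc'). nra.
Qed.

Lemma potential_abs (h : R -> R) (w : R) :
  (forall x, continuity_pt h x) -> (forall x, h (- x) = - h x) ->
  potential h (Rabs w) = potential h w.
Proof.
  intros Hh Hodd. unfold Rabs. destruct (Rcase_abs w) as [Hw|]; [|reflexivity].
  assert (Hd : forall x, is_derive (fun x => potential h (- x) - potential h x) x 0).
  { intros x. evar_last.
    - apply @is_derive_minus; [|apply potential_derive, Hh].
      apply (is_derive_comp (potential h) (fun x => - x)); [apply potential_derive, Hh|].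
      auto_derive; [trivial|reflexivity].
    - unfold minus, plus, opp, scal; simpl. unfold mult; simpl. rewrite Hodd. ring. }
  destruct (MVT_cor2 (fun x => potential h (- x) - potential h x) (fun _ => 0) w 0 Hw)
    as [c [Hc _]].
  - intros x _. apply is_derive_Reals, Hd.
  - rewrite Ropp_0, potential_0 in Hc. lra.
Qed.

(** The slope [y] is exactly w'; the defect sits only in the second equation, and [d = 0] means an
    exact solution. Continuity is asked on the whole line so that two-sided calculus applies at 0,
    while differentiability is asked only for t > 0; negative times carry no equation. *)
Definition almost_solves (n : nat) (h : R -> R) (d T : R) (w y : R -> R) : Prop :=
  (forall t, continuity_pt w t) /\ (forall t, continuity_pt y t) /\ y 0 = 0 /\
  forall t, 0 < t < T -> is_derive w t (y t) /\
    exists r, Rabs r <= d /\ is_derive y t (h (w t) + r - damping n t * y t).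

Definition energy (h : R -> R) (w y : R -> R) (t : R) : R :=
  y t * y t / 2 + potential h (w t).

Lemma energy_continuity (h w y : R -> R) (t : R) : (forall x, continuity_pt h x) ->
  continuity_pt w t -> continuity_pt y t -> continuity_pt (energy h w y) t.
Proof.
  intros Hh Hw Hy. unfold energy, Rdiv. repeat continuity_step.
  apply (continuity_pt_compose w); [assumption|].
  eapply is_derive_continuity_pt, potential_derive, Hh.
Qed.

Lemma energy_derive (n : nat) (h w y : R -> R) (r t : R) : (forall x, continuity_pt h x) ->
  is_derive w t (y t) -> is_derive y t (h (w t) + r - damping n t * y t) ->
  is_derive (energy h w y) t (y t * r - damping n t * (y t * y t)).
Proof.
  intros Hh Hw Hy. unfold energy. evar_last.
  - apply @is_derive_plus.
    + apply (is_derive_ext (fun x => / 2 * (y x * y x)));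
        [intros x; simpl; field|].
      apply (is_derive_scal (fun x => y x * y x)).
      apply @is_derive_mult; [exact Hy|exact Hy|exact Rmult_comm].
    + apply (is_derive_comp (potential h) w); [apply potential_derive, Hh|exact Hw].
  - unfold plus, scal; simpl. unfold mult, plus; simpl. field.
Qed.

Lemma almost_solves_weaken (n : nat) (h : R -> R) (d d' T : R) (w y : R -> R) :
  d <= d' -> almost_solves n h d T w y -> almost_solves n h d' T w y.
Proof.
  intros Hd [Hw [Hy [Hy0 Hs]]]. split; [assumption|]. split; [assumption|].
  split; [assumption|]. intros t Ht. destruct (Hs t Ht) as [Hwt [r [Hr Hyt]]].
  split; [assumption|]. exists r. split; [lra|assumption].
Qed.

(** The damping dissipates and a defect can feed in at most d |y| per unit time. Bounding this
    product by [K], instead of [y] itself, lets [d = 0] and [K = 0] give exact monotonicity with no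
    bound on the slope. *)
Lemma energy_almost_decreasing (n : nat) (h : R -> R) (d T K : R) (w y : R -> R) (s t : R) :
  (1 <= n)%nat -> (forall x, continuity_pt h x) -> almost_solves n h d T w y ->
  (forall x, 0 <= x <= T -> d * Rabs (y x) <= K) -> 0 <= s -> s <= t -> t <= T ->
  energy h w y t <= energy h w y s + K * (t - s).
Proof.
  intros Hn Hh [Hw [Hy [_ Hd]]] HK Hs Hst HtT.
  enough (energy h w y t - K * t <= energy h w y s - K * s) by lra.
  apply (nonincreasing_of_derive (fun x => energy h w y x - K * x)); [assumption| |].
  - intros x _. repeat continuity_step. apply energy_continuity; auto.
  - intros x Hx. destruct (Hd x ltac:(lra)) as [Hwx [r [Hr Hyx]]].
    exists (y x * r - damping n x * (y x * y x) - K). split.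
    + apply @is_derive_minus; [now apply energy_derive|].
      auto_derive; [trivial|ring].
    + assert (Hb := damping_ge_half n x Hn ltac:(lra)).
      assert (y x * r <= K).
      { apply Rle_trans with (1 := Rle_abs _), Rle_trans with (2 := HK x ltac:(lra)).
        rewrite Rabs_mult, Rmult_comm. apply Rmult_le_compat_r; [apply Rabs_pos|assumption]. }
      assert (0 <= damping n x * (y x * y x)) by (apply Rmult_le_pos; nra). lra.
Qed.

(** * The truncated nonlinearity *)

Definition clamp (a w : R) : R := Rmax (- a) (Rmin a w).

Lemma clamp_bound (a w : R) : 0 <= a -> Rabs (clamp a w) <= a.
Proof.
  intros Ha. unfold clamp, Rmax, Rmin. apply Rabs_le.
  destruct (Rle_dec a w); destruct Rle_dec; lra.
Qed.

Lemma clamp_id (a w : R) : Rabs w <= a -> clamp a w = w.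
Proof.
  intros Hw. apply Rabs_le_between in Hw. unfold clamp, Rmax, Rmin.
  destruct (Rle_dec a w); destruct Rle_dec; lra.
Qed.

Lemma clamp_contracting (a w v : R) : Rabs (clamp a w - clamp a v) <= Rabs (w - v).
Proof.
  unfold clamp, Rmax, Rmin.
  destruct (Rle_dec a w), (Rle_dec a v);
    repeat destruct Rle_dec; unfold Rabs; repeat destruct Rcase_abs; lra.
Qed.

Lemma clamp_opp (a w : R) : 0 <= a -> clamp a (- w) = - clamp a w.
Proof.
  intros Ha. unfold clamp, Rmax, Rmin.
  destruct (Rle_dec a w), (Rle_dec a (- w)); repeat destruct Rle_dec; lra.
Qed.

Lemma clamp_pos (a w : R) : 0 < a -> 0 < w -> 0 < clamp a w.
Proof.
  intros Ha Hw. unfold clamp, Rmax, Rmin. destruct (Rle_dec a w); destruct Rle_dec; lra.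
Qed.

(** * Continuity and sign of [H], and their transfer to the truncation *)

Lemma H_opp (p w : R) : H p (- w) = - H p w.
Proof. rewrite !H_signed_power, signed_power_opp. ring. Qed.

Lemma H_diff_weight (p rho w v : R) : 0 < p < 1 -> 0 < rho ->
  Rabs (H p w - H p v)
    <= (/ (1 - p) + 4 * weight p rho w) * Rabs (w - v) + 2 * Rpower rho p.
Proof.
  intros Hp Hr. rewrite !H_signed_power.
  assert (Hs := signed_power_diff_weight p rho w v Hp Hr).
  assert (Hq : 0 < / (1 - p)) by (apply Rinv_0_lt_compat; lra).
  replace (/ (1 - p) * w - signed_power p w - (/ (1 - p) * v - signed_power p v))
    with (/ (1 - p) * (w - v) + - (signed_power p w - signed_power p v)) by ring.
  apply Rle_trans with (1 := Rabs_triang _ _).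
  rewrite Rabs_Ropp, Rabs_mult, (Rabs_pos_eq (/ (1 - p))) by lra. lra.
Qed.

(** For fixed [rho] the weight is at most rho^(p-1), so [H] is Lipschitz up to the error 2 rho^p;
    [rho] is chosen to make that error at most e/2. *)
Lemma H_uniform_continuity (p e : R) : 0 < p < 1 -> 0 < e ->
  exists d, 0 < d /\ forall w v, Rabs (w - v) <= d -> Rabs (H p w - H p v) <= e.
Proof.
  intros Hp He. destruct (Rpower_small p (e / 4)) as [rho [Hr Hre]]; [lra|lra|].
  assert (Hq : 0 < / (1 - p)) by (apply Rinv_0_lt_compat; lra).
  set (L := / (1 - p) + 4 * Rpower rho (p - 1)).
  assert (HL : 0 < L).
  { unfold L. assert (0 < Rpower rho (p - 1)) by apply exp_pos. lra. }
  exists (e / (2 * L)). split; [apply Rdiv_lt_0_compat; lra|].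
  intros w v Hwv.
  apply Rle_trans with (1 := H_diff_weight p rho w v Hp ltac:(lra)).
  assert (Hw := weight_le_rho p rho w Hp ltac:(lra)). assert (Hg := weight_pos p rho w).
  assert (Hle : (/ (1 - p) + 4 * weight p rho w) * Rabs (w - v) <= L * (e / (2 * L))).
  { apply Rmult_le_compat; try apply Rabs_pos; unfold L in *; lra. }
  replace (L * (e / (2 * L))) with (e / 2) in Hle by (field; lra). lra.
Qed.

Lemma H_continuity (p w : R) : 0 < p < 1 -> continuity_pt (H p) w.
Proof.
  intros Hp e He. destruct (H_uniform_continuity p (e / 2) Hp) as [d [Hd Hde]]; [lra|].
  exists d. split; [assumption|]. intros v [_ Hv].
  apply Rle_lt_trans with (e / 2); [|lra]. apply Hde. left. exact Hv.
Qed.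

(** [alpha_max] is the positive zero of [H], that is, the solution of x^(p-1) = 1/(1-p), and x^(p-1)
    is decreasing. *)
Lemma Rpower_gt_below_alpha_max (p a : R) : 0 < p < 1 -> 0 < a < alpha_max p ->
  / (1 - p) < Rpower a (p - 1).
Proof.
  intros Hp Ha.
  replace (/ (1 - p)) with (Rpower (alpha_max p) (p - 1)).
  - apply exp_increasing. assert (ln a < ln (alpha_max p)) by (apply ln_increasing; lra). nra.
  - unfold alpha_max. rewrite Rpower_mult.
    replace (1 / (1 - p) * (p - 1)) with (- (1)) by (field; lra).
    rewrite Rpower_Ropp, Rpower_1; lra.
Qed.

(** On [-a, a] the singular restoring force is at least a^(p-1) |w| and dominates the linear
    repulsion. The resulting gap in the quadratic bound drives the decay at infinity. *)
Lemma H_neg_quadratic (p a w : R) : 0 < p < 1 -> 0 < a < alpha_max p -> Rabs w <= a ->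
  w * H p w <= - (Rpower a (p - 1) - / (1 - p)) * (w * w).
Proof.
  intros Hp Ha Hw. rewrite H_signed_power. unfold signed_power.
  destruct (Req_dec_T w 0) as [->|Hw0]; [lra|]. apply Rabs_pos_lt in Hw0.
  assert (Rpower a (p - 1) <= Rpower (Rabs w) (p - 1)) by (apply Rpower_le_neg; lra). nra.
Qed.

Lemma H_neg (p w : R) : 0 < p < 1 -> 0 < w < alpha_max p -> H p w < 0.
Proof.
  intros Hp Hw. assert (Hg := Rpower_gt_below_alpha_max p w Hp Hw).
  assert (Hq := H_neg_quadratic p w w Hp Hw ltac:(rewrite Rabs_pos_eq; lra)).
  assert (0 < (Rpower w (p - 1) - / (1 - p)) * (w * w)) by (apply Rmult_lt_0_compat; nra).
  apply Rmult_lt_reg_l with w; lra.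
Qed.

Definition truncated (p a w : R) : R := H p (clamp a w).

Lemma truncated_id (p a w : R) : Rabs w <= a -> truncated p a w = H p w.
Proof. intros Hw. unfold truncated. now rewrite clamp_id. Qed.

Lemma truncated_uniform_continuity (p a e : R) : 0 < p < 1 -> 0 < e ->
  exists d, 0 < d /\
    forall w v, Rabs (w - v) <= d -> Rabs (truncated p a w - truncated p a v) <= e.
Proof.
  intros Hp He. destruct (H_uniform_continuity p e Hp He) as [d [Hd Hde]].
  exists d. split; [assumption|]. intros w v Hwv. apply Hde.
  apply Rle_trans with (2 := Hwv), clamp_contracting.
Qed.

Lemma truncated_continuity (p a w : R) : 0 < p < 1 -> continuity_pt (truncated p a) w.
Proof.
  intros Hp e He. destruct (truncated_uniform_continuity p a (e / 2) Hp) as [d [Hd Hde]]; [lra|].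
  exists d. split; [assumption|]. intros v [_ Hv].
  apply Rle_lt_trans with (e / 2); [|lra]. apply Hde. left. exact Hv.
Qed.

Lemma truncated_opp (p a w : R) : 0 <= a -> truncated p a (- w) = - truncated p a w.
Proof. intros Ha. unfold truncated. now rewrite clamp_opp, H_opp. Qed.

Lemma truncated_neg (p a w : R) : 0 < p < 1 -> 0 < a < alpha_max p -> 0 < w ->
  truncated p a w < 0.
Proof.
  intros Hp Ha Hw. apply H_neg; [assumption|]. split; [apply clamp_pos; lra|].
  apply Rle_lt_trans with a; [|lra].
  apply Rle_trans with (1 := Rle_abs _), clamp_bound; lra.
Qed.

(** Only [w] has to lie in [-a, a]: clamping fixes it and does not increase its distance to [v]. *)
Lemma truncated_diff_weight (p a rho w v : R) : 0 < p < 1 -> 0 < rho -> Rabs w <= a ->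
  Rabs (truncated p a w - truncated p a v)
    <= (/ (1 - p) + 4 * weight p rho w) * Rabs (w - v) + 2 * Rpower rho p.
Proof.
  intros Hp Hr Hw. unfold truncated. rewrite (clamp_id a w Hw).
  apply Rle_trans with (1 := H_diff_weight p rho w (clamp a v) Hp Hr).
  apply Rplus_le_compat_r, Rmult_le_compat_l.
  - assert (0 < / (1 - p)) by (apply Rinv_0_lt_compat; lra).
    assert (Hg := weight_pos p rho w). lra.
  - rewrite <- (clamp_id a w Hw) at 1. apply clamp_contracting.
Qed.

Lemma truncated_bounded (p a : R) : 0 < p < 1 -> 0 < a ->
  exists M, 0 < M /\ forall w, Rabs (truncated p a w) <= M.
Proof.
  intros Hp Ha. assert (Hq : 0 < / (1 - p)) by (apply Rinv_0_lt_compat; lra).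
  exists ((/ (1 - p) + 4) * a + 2). split; [nra|]. intros w. unfold truncated.
  assert (Hc := clamp_bound a w ltac:(lra)). set (x := clamp a w) in *.
  (* Comparing with the value at 0 at the scale [rho = 1], where the weight is at most 1. *)
  assert (Hd := H_diff_weight p 1 x 0 Hp ltac:(lra)).
  assert (Hg := weight_le_rho p 1 x Hp ltac:(lra)). assert (Hg0 := weight_pos p 1 x).
  replace (H p 0) with 0 in Hd by (rewrite H_signed_power, signed_power_0; ring).
  assert (Hone : forall c, Rpower 1 c = 1).
  { intros c. unfold Rpower. now rewrite ln_1, Rmult_0_r, exp_0. }
  rewrite !Hone in *. rewrite !Rminus_0_r in Hd.
  assert (Hx := Rabs_pos x). nra.
Qed.

Lemma truncated_potential_abs (p a w : R) : 0 < p < 1 -> 0 < a ->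
  potential (truncated p a) (Rabs w) = potential (truncated p a) w.
Proof.
  intros Hp Ha. apply potential_abs.
  - intros x. now apply truncated_continuity.
  - intros x. apply truncated_opp; lra.
Qed.

Lemma truncated_potential_lt (p a u v : R) : 0 < p < 1 -> 0 < a < alpha_max p ->
  Rabs u < Rabs v -> potential (truncated p a) u < potential (truncated p a) v.
Proof.
  intros Hp Ha Huv.
  rewrite <- (truncated_potential_abs p a u), <- (truncated_potential_abs p a v) by lra.
  apply potential_increasing; [intros x; now apply truncated_continuity|assumption|].
  intros x Hx. assert (Hu := Rabs_pos u). apply truncated_neg; lra.
Qed.

Lemma truncated_potential_ge_0 (p a w : R) : 0 < p < 1 -> 0 < a < alpha_max p ->
  0 <= potential (truncated p a) w.
Proof.
  intros Hp Ha. rewrite <- (potential_0 (truncated p a)).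
  destruct (Req_dec w 0) as [->|Hw]; [lra|].
  left. apply truncated_potential_lt; try assumption. rewrite Rabs_R0. now apply Rabs_pos_lt.
Qed.

Lemma potential_lipschitz (h : R -> R) (M u v : R) : (forall x, continuity_pt h x) ->
  (forall x, Rabs (h x) <= M) -> Rabs (potential h u - potential h v) <= M * Rabs (u - v).
Proof.
  intros Hh HM.
  destruct (MVT_abs (potential h) (fun x => - h x) v u) as [c [Hc _]].
  - intros x _. apply is_derive_Reals, potential_derive, Hh.
  - rewrite Hc, Rabs_Ropp. apply Rmult_le_compat_r; [apply Rabs_pos|apply HM].
Qed.

(** Both summands of the energy are nonnegative, and the potential increases strictly with |w|, so a
    small energy controls [w] and [y] separately. The factor 4 leaves room for the comparison: a
    switch at level 2e, e for the gap between the two energies, e for the drift due to defects. *)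
Lemma small_of_small_energy (p a eta : R) : 0 < p < 1 -> 0 < a < alpha_max p -> 0 < eta ->
  exists e, 0 < e /\ forall w y t, energy (truncated p a) w y t <= 4 * e ->
    Rabs (w t) <= eta /\ Rabs (y t) <= eta.
Proof.
  intros Hp Ha Heta.
  assert (HV : 0 < potential (truncated p a) eta).
  { rewrite <- (potential_0 (truncated p a)). apply truncated_potential_lt; try assumption.
    rewrite Rabs_R0, Rabs_pos_eq; lra. }
  exists (Rmin (potential (truncated p a) eta / 4) (eta * eta / 8)). split.
  { apply Rmin_glb_lt; [lra|nra]. }
  intros w y t HE. unfold energy in HE.
  assert (H1 := Rmin_l (potential (truncated p a) eta / 4) (eta * eta / 8)).
  assert (H2 := Rmin_r (potential (truncated p a) eta / 4) (eta * eta / 8)).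
  assert (Hw0 := truncated_potential_ge_0 p a (w t) Hp Ha).
  split.
  - destruct (Rle_dec (Rabs (w t)) eta) as [|Hw]; [assumption|].
    assert (Hlt := truncated_potential_lt p a eta (w t) Hp Ha).
    rewrite (Rabs_pos_eq eta) in Hlt by lra. specialize (Hlt ltac:(lra)). nra.
  - apply Rabs_le. split; nra.
Qed.

(** * Comparison of approximate solutions *)

Lemma almost_solves_bound (n : nat) (h : R -> R) (M d T : R) (w y : R -> R) :
  (1 <= n)%nat -> (forall x, Rabs (h x) <= M) -> 0 <= d -> almost_solves n h d T w y ->
  forall t, 0 <= t <= T -> Rabs (y t) <= (M + d) * t.
Proof.
  intros Hn HM Hd0 [_ [Hy [Hy0 Hd]]]. assert (HM0 := HM 0). assert (Ha := Rabs_pos (h 0)).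
  apply (damped_bound n); try assumption; [lra|].
  intros t Ht. destruct (Hd t Ht) as [_ [r [Hr Hyt]]]. exists (h (w t) + r).
  split; [|assumption]. apply Rle_trans with (1 := Rabs_triang _ _).
  specialize (HM (w t)). lra.
Qed.

Definition dist2 (w1 y1 w2 y2 : R -> R) (t : R) : R :=
  (w1 t - w2 t) * (w1 t - w2 t) + (y1 t - y2 t) * (y1 t - y2 t).

(* While the energy of the first solution is at least [e], the function
   [K = B f_rho(w1) y1 + A t], with [f_rho] the smoothed power, satisfies
   [K' >= 2 + 1/(1-p) + 4 weight(w1)] and is bounded uniformly in [rho]: where [|y1|] is not
   small the first term provides the singular weight, elsewhere [|w1|] is not small and the weight
   is bounded. So [exp K] is an integrating factor for the Gronwall inequality. *)
Lemma gronwall_weight (n : nat) (p a T e : R) :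
  (1 <= n)%nat -> 0 < p < 1 -> 0 < a < alpha_max p -> 0 <= T -> 0 < e ->
  exists Kb, 0 <= Kb /\ forall rho d w y tau, 0 < rho <= 1 -> 0 <= d <= 1 ->
    almost_solves n (truncated p a) d T w y -> 0 <= tau <= T ->
    (forall t, 0 <= t <= tau -> e <= energy (truncated p a) w y t) ->
    (forall t, 0 <= t <= tau -> Rabs (w t) <= a) ->
    exists K, (forall t, continuity_pt K t) /\
      (forall t, 0 <= t <= tau -> Rabs (K t) <= Kb) /\
      forall t, 0 < t < tau -> exists l, is_derive K t l /\
        2 + / (1 - p) + 4 * weight p rho (w t) <= l.
Proof.
  intros Hn Hp Ha HT He.
  destruct (truncated_bounded p a Hp ltac:(lra)) as [M [HM0 HM]].
  assert (Hq : 0 < / (1 - p)) by (apply Rinv_0_lt_compat; lra).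
  assert (HN := INR_ge_1 n Hn).
  set (F := a * a + 1). set (Y := (M + 1) * T).
  set (Q := (M + 1) * (1 + INR n + T * T)). set (c := e / (2 * M)).
  set (B := 4 / (p * e)).
  set (A := B * (F * Q) + (2 + / (1 - p) + 4 * Rpower c (p - 1))).
  assert (Hpe : 0 < p * e) by nra.
  assert (HB : 0 < B) by (apply Rdiv_lt_0_compat; lra).
  assert (Hc : 0 < c) by (apply Rdiv_lt_0_compat; lra).
  assert (HF : 0 < F) by (unfold F; assert (0 <= a * a) by nra; lra).
  assert (HQ : 0 < Q).
  { unfold Q. assert (0 <= T * T) by nra. apply Rmult_lt_0_compat; lra. }
  assert (HY : 0 <= Y) by (unfold Y; apply Rmult_le_pos; lra).
  assert (HA : 0 < A).
  { unfold A. assert (0 < Rpower c (p - 1)) by apply exp_pos.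
    assert (0 < B * (F * Q)) by (apply Rmult_lt_0_compat; [|apply Rmult_lt_0_compat]; lra). lra. }
  exists (B * (F * Y) + A * T). split.
  { apply Rplus_le_le_0_compat; apply Rmult_le_pos; try lra. apply Rmult_le_pos; lra. }
  intros rho d w y tau Hrho Hd Hsol Htau HE Hwa.
  assert (Hyb := almost_solves_bound n _ M d T w y Hn HM ltac:(lra) Hsol).
  destruct Hsol as [Hw [Hy [Hy0 Hder]]].
  exists (fun t => B * (w t * weight p rho (w t) * y t) + A * t).
  split; [|split].
  - intros t. repeat continuity_step; try apply Hw; try apply Hy.
    apply (continuity_pt_compose w (weight p rho)); [apply Hw|].
    eapply is_derive_continuity_pt. unfold weight, Rpower. auto_derive; [nra|reflexivity].
  - intros t Ht. apply Rle_trans with (1 := Rabs_triang _ _). apply Rplus_le_compat.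
    + rewrite !Rabs_mult, (Rabs_pos_eq B) by lra. apply Rmult_le_compat_l; [lra|].
      rewrite <- Rabs_mult.
      apply Rmult_le_compat; try apply Rabs_pos.
      * apply smoothed_power_bound; try assumption. now apply Hwa.
      * specialize (Hyb t ltac:(lra)). unfold Y. nra.
    + rewrite Rabs_pos_eq by nra. nra.
  - intros t Ht. destruct (Hder t ltac:(lra)) as [Hwt [r [Hr Hyt]]].
    destruct (smoothed_power_derive p rho (w t) Hp ltac:(lra)) as [l [Hl Hlg]].
    set (g := weight p rho (w t)) in *. assert (Hg : 0 < g) by apply weight_pos.
    set (y' := truncated p a (w t) + r - damping n t * y t) in *.
    exists (B * (l * y t * y t + w t * g * y') + A). split.
    + evar_last.
      * apply @is_derive_plus; [apply is_derive_scal|auto_derive; [trivial|reflexivity]].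
        apply @is_derive_mult; [|exact Hyt|exact Rmult_comm].
        apply (is_derive_comp (fun x => x * weight p rho x) w); [exact Hl|exact Hwt].
      * unfold plus, mult, scal; simpl. unfold plus, mult; simpl. fold g. ring.
    + assert (Hy' : Rabs y' <= Q).
      { unfold y'. specialize (Hyb t ltac:(lra)). specialize (HM (w t)).
        assert (Hdy : Rabs (damping n t * y t) <= (INR n + T * T) * (M + 1)).
        { rewrite Rabs_mult. assert (Hdp := damping_ge_half n t Hn ltac:(lra)).
          rewrite (Rabs_pos_eq (damping n t)) by lra.
          apply Rle_trans with (damping n t * ((M + 1) * t)).
          - apply Rmult_le_compat_l; nra.
          - replace (damping n t * ((M + 1) * t)) with ((INR n - 1 + t * t / 2) * (M + 1))
              by (unfold damping; field; lra).
            apply Rmult_le_compat_r; nra. }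
        apply Rabs_le_between in Hdy. apply Rabs_le_between in Hr. apply Rabs_le_between in HM.
        unfold Q. apply Rabs_le. lra. }
      assert (Hfy : - (F * Q) <= w t * g * y').
      { assert (Hb : Rabs (w t * g * y') <= F * Q).
        { rewrite Rabs_mult. apply Rmult_le_compat; try apply Rabs_pos; [|assumption].
          apply smoothed_power_bound; try assumption. apply Hwa; lra. }
        apply Rabs_le_between in Hb. lra. }
      assert (Hmain : 4 * g <= B * (l * (y t * y t)) + 4 * Rpower c (p - 1)).
      { assert (Hcp : 0 < Rpower c (p - 1)) by apply exp_pos.
        assert (Hy2 : 0 <= y t * y t) by nra.
        destruct (Rle_dec e (y t * y t)) as [Hey|Hey].
        - assert (B * (p * g * e) <= B * (l * (y t * y t))).
          { apply Rmult_le_compat_l; [lra|]. apply Rmult_le_compat; nra. }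
          replace (B * (p * g * e)) with (4 * g) in H by (unfold B; field; lra). lra.
        - assert (g <= Rpower c (p - 1)).
          { apply weight_le; try assumption.
            specialize (HE t ltac:(lra)). unfold energy in HE.
            assert (HV := potential_lipschitz (truncated p a) M (w t) 0
              (fun x => truncated_continuity p a x Hp) HM).
            rewrite potential_0, !Rminus_0_r in HV.
            assert (HV' := Rle_abs (potential (truncated p a) (w t))).
            apply Rmult_le_reg_l with M; [lra|].
            replace (M * c) with (e / 2) by (unfold c; field; lra). lra. }
          assert (0 <= B * (l * (y t * y t)))
            by (apply Rmult_le_pos; [lra|apply Rmult_le_pos; nra]).
          lra. }
      unfold A.
      assert (B * - (F * Q) <= B * (w t * g * y')) by (apply Rmult_le_compat_l; lra).
      lra.
Qed.

(** Here z and x are the differences of positions and slopes, s that of the forces, b the damping,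
    and l the derivative of the exponent. The cross terms 2zx and 2|x|k each cost one unit of z^2 +
    x^2, hence the 2 in 2 + c; the damping only helps. *)
Lemma gronwall_algebra (z x s b c k l : R) :
  Rabs s <= c * Rabs z + k -> 0 <= b -> 0 <= c -> 2 + c <= l ->
  2 * (z * x) + 2 * (x * (s - b * x)) - l * (z * z + x * x) <= k ^ 2.
Proof.
  intros Hs Hb Hc Hl.
  assert (Hx : Rabs x * Rabs x = x * x) by (rewrite <- Rabs_mult; apply Rabs_pos_eq; nra).
  assert (Hz : Rabs z * Rabs z = z * z) by (rewrite <- Rabs_mult; apply Rabs_pos_eq; nra).
  assert (Hamgm : forall u v : R, 2 * (u * v) <= u * u + v * v).
  { intros u v. assert (0 <= (u - v) * (u - v)) by apply Rle_0_sqr. lra. }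
  assert (Hxz := Hamgm z x). assert (Habs := Hamgm (Rabs x) (Rabs z)).
  assert (Hxk := Hamgm (Rabs x) k).
  assert (Hbx : 0 <= b * (x * x)) by (apply Rmult_le_pos; nra).
  assert (Hxs : x * s <= Rabs x * (c * Rabs z + k)).
  { apply Rle_trans with (1 := Rle_abs _). rewrite Rabs_mult.
    apply Rmult_le_compat_l; [apply Rabs_pos|assumption]. }
  assert (Hcz : 2 * (Rabs x * Rabs z) * c <= (z * z + x * x) * c)
    by (apply Rmult_le_compat_r; lra).
  assert (HlD : (2 + c) * (z * z + x * x) <= l * (z * z + x * x))
    by (apply Rmult_le_compat_r; nra).
  assert (0 <= z * z) by nra. lra.
Qed.

(** [C] is fixed before [rho] and [d], so that both can be made small afterwards. In the
    inhomogeneous term 2 rho^p is the price of smoothing and 2 d that of the two defects. *)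
Lemma gronwall (n : nat) (p a T e : R) :
  (1 <= n)%nat -> 0 < p < 1 -> 0 < a < alpha_max p -> 0 <= T -> 0 < e ->
  exists C, 0 <= C /\ forall rho d w1 y1 w2 y2 tau, 0 < rho <= 1 -> 0 <= d <= 1 ->
    almost_solves n (truncated p a) d T w1 y1 ->
    almost_solves n (truncated p a) d T w2 y2 -> 0 <= tau <= T ->
    (forall t, 0 <= t <= tau -> e <= energy (truncated p a) w1 y1 t) ->
    (forall t, 0 <= t <= tau -> Rabs (w1 t) <= a) ->
    dist2 w1 y1 w2 y2 tau
      <= C * (dist2 w1 y1 w2 y2 0 + T * (2 * Rpower rho p + 2 * d) ^ 2).
Proof.
  intros Hn Hp Ha HT He.
  destruct (gronwall_weight n p a T e Hn Hp Ha HT He) as [Kb [HKb HK]].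
  exists (exp Kb * exp Kb). split; [apply Rmult_le_pos; left; apply exp_pos|].
  intros rho d w1 y1 w2 y2 tau Hrho Hd Hs1 Hs2 Htau HE Hwa.
  destruct (HK rho d w1 y1 tau Hrho Hd Hs1 Htau HE Hwa) as [K [HKc [HKle HKd]]].
  destruct Hs1 as [Hw1 [Hy1 [_ Hd1]]]. destruct Hs2 as [Hw2 [Hy2 [_ Hd2]]].
  set (k0 := 2 * Rpower rho p + 2 * d). set (D := dist2 w1 y1 w2 y2).
  assert (Hexp : forall t, 0 <= t <= tau -> exp (- K t) <= exp Kb /\ 1 <= exp (- K t) * exp Kb).
  { intros t Ht. specialize (HKle t Ht). apply Rabs_le_between in HKle.
    assert (Hle : forall u v, u <= v -> exp u <= exp v).
    { intros u v [Huv| ->]; [left; now apply exp_increasing|lra]. }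
    split; [apply Hle; lra|]. rewrite <- exp_plus, <- exp_0. apply Hle. lra. }
  assert (HD0 : forall t, 0 <= D t).
  { intros t. apply Rplus_le_le_0_compat; apply Rle_0_sqr. }
  assert (Hmono : D tau * exp (- K tau) - exp Kb * k0 ^ 2 * tau
                  <= D 0 * exp (- K 0) - exp Kb * k0 ^ 2 * 0).
  { apply (nonincreasing_of_derive (fun t => D t * exp (- K t) - exp Kb * k0 ^ 2 * t)); [lra| |].
    - intros t _. unfold D, dist2. repeat continuity_step; auto.
      apply (continuity_pt_compose (fun s => - K s) exp).
      + apply (continuity_pt_opp K), HKc.
      + apply derivable_continuous_pt, derivable_pt_exp.
    - intros t Ht. destruct (HKd t Ht) as [l [Hl Hlg]].
      destruct (Hd1 t ltac:(lra)) as [Hw1t [r1 [Hr1 Hy1t]]].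
      destruct (Hd2 t ltac:(lra)) as [Hw2t [r2 [Hr2 Hy2t]]].
      set (g := weight p rho (w1 t)) in *. assert (Hg : 0 < g) by apply weight_pos.
      set (h1 := truncated p a (w1 t)) in *. set (h2 := truncated p a (w2 t)) in *.
      set (z := w1 t - w2 t). set (x := y1 t - y2 t).
      set (D' := 2 * (z * x) + 2 * (x * (h1 - h2 + (r1 - r2) - damping n t * x))).
      exists ((D' - l * D t) * exp (- K t) - exp Kb * k0 ^ 2). split.
      + evar_last.
        * apply @is_derive_minus; [|auto_derive; [trivial|reflexivity]].
          apply @is_derive_mult; [| |exact Rmult_comm].
          -- apply @is_derive_plus; apply @is_derive_mult; try exact Rmult_comm;
               apply @is_derive_minus; eassumption.
          -- apply (is_derive_comp exp (fun s => - K s)); [apply is_derive_exp|].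
             apply @is_derive_opp, Hl.
        * unfold D, dist2, D', z, x, plus, minus, mult, opp, scal; simpl.
          unfold plus, minus, mult, opp; simpl. unfold plus, mult, opp; simpl. ring.
      + assert (HD' : D' - l * D t <= k0 ^ 2).
        { assert (Hh : Rabs (h1 - h2 + (r1 - r2)) <= (/ (1 - p) + 4 * g) * Rabs z + k0).
          { apply Rle_trans with (1 := Rabs_triang _ _).
            assert (Hh := truncated_diff_weight p a rho (w1 t) (w2 t) Hp ltac:(lra)
              (Hwa t ltac:(lra))). fold h1 h2 g z in Hh.
            assert (Rabs (r1 - r2) <= 2 * d).
            { apply Rabs_le. apply Rabs_le_between in Hr1. apply Rabs_le_between in Hr2. lra. }
            unfold k0. lra. }
          assert (Hb := damping_ge_half n t Hn ltac:(lra)).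
          assert (Hq : 0 < / (1 - p)) by (apply Rinv_0_lt_compat; lra).
          apply (gronwall_algebra z x _ _ (/ (1 - p) + 4 * g)); lra. }
        destruct (Hexp t ltac:(lra)) as [Hex _].
        assert (Hpos := exp_pos (- K t)). assert (0 <= k0 ^ 2) by nra. nra. }
  destruct (Hexp tau ltac:(lra)) as [_ Htau1]. destruct (Hexp 0 ltac:(lra)) as [H01 _].
  assert (Hpos := exp_pos Kb). specialize (HD0 0) as HD00. specialize (HD0 tau).
  assert (Hk : 0 <= k0 ^ 2) by nra.
  assert (Hk0 : k0 ^ 2 * tau <= T * k0 ^ 2) by nra.
  assert (HDe : D tau * exp (- K tau) <= exp Kb * (D 0 + T * k0 ^ 2)).
  { assert (D 0 * exp (- K 0) <= D 0 * exp Kb) by (apply Rmult_le_compat_l; lra). nra. }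
  apply Rle_trans with (D tau * (exp (- K tau) * exp Kb)).
  - rewrite <- (Rmult_1_r (D tau)) at 1. now apply Rmult_le_compat_l.
  - replace (D tau * (exp (- K tau) * exp Kb)) with (D tau * exp (- K tau) * exp Kb) by ring.
    replace (exp Kb * exp Kb * (D 0 + T * k0 ^ 2)) with (exp Kb * (D 0 + T * k0 ^ 2) * exp Kb)
      by ring.
    now apply Rmult_le_compat_r; [lra|].
Qed.

Lemma abs_le_of_sqr_le (x m : R) : 0 <= m -> x * x <= m * m -> Rabs x <= m.
Proof. intros Hm Hx. apply Rabs_le. split; nra. Qed.

Lemma energy_diff_le (h : R -> R) (M Y : R) (w1 y1 w2 y2 : R -> R) (t : R) :
  (forall x, continuity_pt h x) -> (forall x, Rabs (h x) <= M) ->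
  Rabs (y1 t) <= Y -> Rabs (y2 t) <= Y ->
  Rabs (energy h w1 y1 t - energy h w2 y2 t)
    <= Y * Rabs (y1 t - y2 t) + M * Rabs (w1 t - w2 t).
Proof.
  intros Hh HM HY1 HY2. unfold energy.
  replace (_ - _) with ((y1 t + y2 t) / 2 * (y1 t - y2 t)
    + (potential h (w1 t) - potential h (w2 t))) by field.
  apply Rle_trans with (1 := Rabs_triang _ _), Rplus_le_compat.
  - rewrite Rabs_mult. apply Rmult_le_compat_r; [apply Rabs_pos|].
    apply Rabs_le_between in HY1. apply Rabs_le_between in HY2. apply Rabs_le. lra.
  - now apply potential_lipschitz.
Qed.

(** The constants are chosen in the order [e], [C], [mu], [sigma], [rho], [d]. While the first
    energy stays at least [e], Gronwall keeps the pair [mu]-close. From a time when that energy is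
    at most 2e, the second one starts from at most 3e; the drift adds at most e to either, so both
    solutions remain within eta/2 of 0. *)
Lemma comparison (n : nat) (p a T eta : R) :
  (1 <= n)%nat -> 0 < p < 1 -> 0 < a < alpha_max p -> 0 <= T -> 0 < eta ->
  exists d, 0 < d <= 1 /\ forall w1 y1 w2 y2,
    almost_solves n (truncated p a) d T w1 y1 ->
    almost_solves n (truncated p a) d T w2 y2 ->
    Rabs (w1 0 - w2 0) <= d -> (forall t, 0 <= t <= T -> Rabs (w1 t) <= a) ->
    forall t, 0 <= t <= T -> Rabs (w1 t - w2 t) <= eta /\ Rabs (y1 t - y2 t) <= eta.
Proof.
  intros Hn Hp Ha HT Heta.
  assert (Hcont : forall x, continuity_pt (truncated p a) x)
    by (intros x; now apply truncated_continuity).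
  destruct (truncated_bounded p a Hp ltac:(lra)) as [M [HM0 HM]].
  destruct (small_of_small_energy p a (eta / 2) Hp Ha) as [e [He Hsmall]]; [lra|].
  destruct (gronwall n p a T e Hn Hp Ha HT He) as [C [HC Hgron]].
  assert (HY : exists Y, Y = (M + 1) * T /\ 0 <= Y).
  { exists ((M + 1) * T). split; [reflexivity|]. apply Rmult_le_pos; lra. }
  destruct HY as [Y [HYdef HY]].
  (* Solutions that are [mu]-close have energies differing by at most [e], since slopes are bounded
     by [Y] and the potential is [M]-Lipschitz. *)
  assert (Hmu : exists mu, 0 < mu <= eta /\ (Y + M) * mu <= e).
  { exists (Rmin eta (e / (Y + M))).
    assert (0 < e / (Y + M)) by (apply Rdiv_lt_0_compat; lra).
    assert (H1 := Rmin_l eta (e / (Y + M))). assert (H2 := Rmin_r eta (e / (Y + M))).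
    repeat split; [now apply Rmin_glb_lt|assumption|].
    replace e with ((Y + M) * (e / (Y + M))) at 2 by (field; lra).
    apply Rmult_le_compat_l; lra. }
  destruct Hmu as [mu [Hmu HmuE]].
  assert (HC1 : 1 <= (C + 1) * (1 + T)) by nra.
  (* [sigma] bounds both the initial distance and the error 2 rho^p + 2 d, and Gronwall turns it
     into [mu]. *)
  assert (Hsigma : exists sigma, 0 < sigma <= mu /\ C * (sigma * sigma * (1 + T)) <= mu * mu).
  { exists (mu / ((C + 1) * (1 + T))).
    assert (Hs : 0 < mu / ((C + 1) * (1 + T))) by (apply Rdiv_lt_0_compat; lra).
    set (sigma := mu / ((C + 1) * (1 + T))) in *.
    assert (Hmus : mu = sigma * ((C + 1) * (1 + T))) by (unfold sigma; field; lra).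
    clearbody sigma. split; [split; [assumption|nra]|].
    rewrite Hmus at 1. rewrite Hmus.
    replace (sigma * ((C + 1) * (1 + T)) * (sigma * ((C + 1) * (1 + T))))
      with (sigma * sigma * (1 + T) * ((C + 1) * ((C + 1) * (1 + T)))) by ring.
    rewrite (Rmult_comm C). apply Rmult_le_compat_l; nra. }
  destruct Hsigma as [sigma [Hsigma HsigmaC]].
  destruct (Rpower_small p (sigma / 4)) as [rho [Hrho Hrhop]]; [lra|lra|].
  (* The last condition limits the energy gained from the defect over [0, T] to [e]. *)
  assert (Hdelta : exists d, 0 < d <= 1 /\ d <= sigma / 4 /\ d * (Y * T) <= e).
  { assert (HYT : 0 <= Y * T) by (now apply Rmult_le_pos).
    assert (0 < e / (Y * T + 1)) by (apply Rdiv_lt_0_compat; lra).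
    exists (Rmin 1 (Rmin (sigma / 4) (e / (Y * T + 1)))).
    assert (H1 := Rmin_l 1 (Rmin (sigma / 4) (e / (Y * T + 1)))).
    assert (H2 := Rmin_r 1 (Rmin (sigma / 4) (e / (Y * T + 1)))).
    assert (H3 := Rmin_l (sigma / 4) (e / (Y * T + 1))).
    assert (H4 := Rmin_r (sigma / 4) (e / (Y * T + 1))).
    assert (H5 : 0 < Rmin 1 (Rmin (sigma / 4) (e / (Y * T + 1))))
      by (repeat apply Rmin_glb_lt; lra).
    repeat split; try lra.
    apply Rle_trans with (e / (Y * T + 1) * (Y * T + 1)); [|right; field; lra].
    apply Rmult_le_compat; lra. }
  destruct Hdelta as [d [Hd [Hdsigma HdYT]]].
  exists d. split; [assumption|]. intros w1 y1 w2 y2 Hs1 Hs2 H0 Hwa.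
  assert (HyY : forall w y, almost_solves n (truncated p a) d T w y ->
    forall t, 0 <= t <= T -> Rabs (y t) <= Y).
  { intros w y Hs t Ht. rewrite HYdef.
    apply Rle_trans with (1 := almost_solves_bound n _ M d T w y Hn HM ltac:(lra) Hs t Ht).
    apply Rmult_le_compat; lra. }
  assert (Hdrop : forall w y, almost_solves n (truncated p a) d T w y -> forall s t,
    0 <= s -> s <= t -> t <= T ->
    energy (truncated p a) w y t <= energy (truncated p a) w y s + e).
  { intros w y Hs s t Hs0 Hst Ht.
    apply Rle_trans with (1 := energy_almost_decreasing n _ d T (d * Y) w y s t Hn Hcont Hs
      (fun x Hx => Rmult_le_compat_l d _ _ ltac:(lra) (HyY w y Hs x Hx)) Hs0 Hst Ht).
    apply Rplus_le_compat_l. apply Rle_trans with (2 := HdYT). rewrite Rmult_assoc.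
    repeat apply Rmult_le_compat_l; lra. }
  assert (Hclose : forall tau, 0 <= tau <= T ->
    (forall t, 0 <= t <= tau -> e <= energy (truncated p a) w1 y1 t) ->
    Rabs (w1 tau - w2 tau) <= mu /\ Rabs (y1 tau - y2 tau) <= mu).
  { intros tau Htau HE.
    assert (HD := Hgron rho d w1 y1 w2 y2 tau Hrho ltac:(lra) Hs1 Hs2 Htau HE
      (fun t Ht => Hwa t ltac:(lra))).
    assert (Hmu2 : dist2 w1 y1 w2 y2 tau <= mu * mu).
    { apply Rle_trans with (1 := HD), Rle_trans with (2 := HsigmaC).
      apply Rmult_le_compat_l; [assumption|].
      assert (HD0 : dist2 w1 y1 w2 y2 0 <= sigma * sigma).
      { unfold dist2. destruct Hs1 as [_ [_ [-> _]]]. destruct Hs2 as [_ [_ [-> _]]].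
        apply Rabs_le_between in H0. nra. }
      assert (Hk : (2 * Rpower rho p + 2 * d) ^ 2 <= sigma * sigma).
      { assert (0 < Rpower rho p) by apply exp_pos. simpl. rewrite Rmult_1_r.
        apply Rmult_le_compat; lra. }
      assert (T * (2 * Rpower rho p + 2 * d) ^ 2 <= T * (sigma * sigma))
        by (apply Rmult_le_compat_l; assumption).
      lra. }
    unfold dist2 in Hmu2.
    split; apply abs_le_of_sqr_le; try lra;
      [assert (H1 := Rle_0_sqr (y1 tau - y2 tau))|assert (H1 := Rle_0_sqr (w1 tau - w2 tau))];
      unfold Rsqr in H1; lra. }
  intros t Ht.
  (* The threshold is 2e because the energy can rise by [e]: being at least 2e at a time guarantees
     at least [e] at all earlier times, as [Hclose] requires. Otherwise [t0] is either 0, where the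
     data are close, or a time at which the energy equals 2e. *)
  destruct (Rle_dec (2 * e) (energy (truncated p a) w1 y1 t)) as [Ht2|Ht2].
  - destruct (Hclose t Ht) as [Hz Hx]; [|split; lra].
    intros s Hs. assert (H1 := Hdrop w1 y1 Hs1 s t ltac:(lra) ltac:(lra) ltac:(lra)). lra.
  - assert (Hswitch : exists t0, 0 <= t0 <= t /\ energy (truncated p a) w1 y1 t0 <= 2 * e /\
      Rabs (w1 t0 - w2 t0) <= mu /\ Rabs (y1 t0 - y2 t0) <= mu).
    { destruct (Rle_dec (energy (truncated p a) w1 y1 0) (2 * e)) as [HE0|HE0].
      - exists 0. repeat split; try lra.
        destruct Hs1 as [_ [_ [-> _]]]. destruct Hs2 as [_ [_ [-> _]]].
        rewrite Rminus_diag, Rabs_R0. lra.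
      - destruct (IVT_cor (fun s => energy (truncated p a) w1 y1 s - 2 * e) 0 t)
          as [t0 [Ht0 HEt0]].
        + intros s. repeat continuity_step.
          destruct Hs1 as [Hw1 [Hy1 _]]. now apply energy_continuity.
        + lra.
        + nra.
        + exists t0. split; [assumption|]. split; [lra|]. apply Hclose; [lra|].
          intros s Hs. assert (H1 := Hdrop w1 y1 Hs1 s t0 ltac:(lra) ltac:(lra) ltac:(lra)). lra. }
    destruct Hswitch as [t0 [Ht0 [HE1 [Hz Hx]]]].
    assert (HE2 : energy (truncated p a) w2 y2 t0 <= 3 * e).
    { assert (Hdiff := energy_diff_le (truncated p a) M Y w1 y1 w2 y2 t0 Hcont HM
        (HyY w1 y1 Hs1 t0 ltac:(lra)) (HyY w2 y2 Hs2 t0 ltac:(lra))).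
      apply Rabs_le_between in Hdiff.
      assert (Y * Rabs (y1 t0 - y2 t0) <= Y * mu) by (apply Rmult_le_compat_l; lra).
      assert (M * Rabs (w1 t0 - w2 t0) <= M * mu) by (apply Rmult_le_compat_l; lra). lra. }
    assert (HEt1 := Hdrop w1 y1 Hs1 t0 t ltac:(lra) ltac:(lra) ltac:(lra)).
    assert (HEt2 := Hdrop w2 y2 Hs2 t0 t ltac:(lra) ltac:(lra) ltac:(lra)).
    destruct (Hsmall w1 y1 t ltac:(lra)) as [Hw1 Hy1].
    destruct (Hsmall w2 y2 t ltac:(lra)) as [Hw2 Hy2].
    apply Rabs_le_between in Hw1. apply Rabs_le_between in Hw2.
    apply Rabs_le_between in Hy1. apply Rabs_le_between in Hy2.
    split; apply Rabs_le; lra.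
Qed.

(** * Existence by delayed approximations *)

(** Variation of constants for y' + [damping] y = h with y(0) = 0. The integrating factor vanishes
    at 0 when n >= 2, so the value 0 is prescribed for t <= 0; the bound linear in t makes the two
    pieces fit continuously. *)
Definition damped_response (n : nat) (h : R -> R) (t : R) : R :=
  if Rle_dec t 0 then 0
  else / integrating_factor n t * RInt (fun s => integrating_factor n s * h s) 0 t.

Lemma integrating_factor_increasing (n : nat) (s t : R) :
  0 <= s <= t -> integrating_factor n s <= integrating_factor n t.
Proof.
  intros Hst. unfold integrating_factor. apply Rmult_le_compat.
  - apply pow_le; lra.
  - left; apply exp_pos.
  - apply pow_incr; lra.
  - destruct (Rle_lt_or_eq_dec (s * s / 4) (t * t / 4) ltac:(nra)) as [Hlt|Heq].
    + left. now apply exp_increasing.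
    + rewrite Heq. lra.
Qed.

Lemma damped_response_npos (n : nat) (h : R -> R) (t : R) :
  t <= 0 -> damped_response n h t = 0.
Proof. intros Ht. unfold damped_response. destruct (Rle_dec t 0); lra. Qed.

(** The integrating factor is nondecreasing on [0, t], so the kernel, its value at s divided by that
    at t, is at most 1. *)
Lemma damped_response_bound (n : nat) (h : R -> R) (M t : R) :
  (forall x, continuity_pt h x) -> (forall x, Rabs (h x) <= M) ->
  Rabs (damped_response n h t) <= M * Rmax 0 t.
Proof.
  intros Hh HM. assert (HM0 := HM 0). assert (Hh0 := Rabs_pos (h 0)).
  unfold damped_response. destruct (Rle_dec t 0) as [Ht|Ht].
  - rewrite Rabs_R0, Rmax_left by lra. lra.
  - rewrite Rmax_right by lra. assert (Hq := integrating_factor_pos n t ltac:(lra)).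
    rewrite Rabs_mult, (Rabs_pos_eq (/ _)) by (left; now apply Rinv_0_lt_compat).
    apply Rmult_le_reg_l with (1 := Hq). rewrite <- Rmult_assoc, Rinv_r, Rmult_1_l by lra.
    replace (integrating_factor n t * (M * t))
      with ((t - 0) * (integrating_factor n t * M)) by ring.
    apply abs_RInt_le_const; [lra| |].
    + apply @ex_RInt_continuous. intros x _.
      apply continuity_pt_filterlim, continuity_pt_mul;
        [apply integrating_factor_continuity|apply Hh].
    + intros s Hs. rewrite Rabs_mult. apply Rmult_le_compat; try apply Rabs_pos; [|apply HM].
      rewrite Rabs_pos_eq; [now apply integrating_factor_increasing|].
      apply Rmult_le_pos; [apply pow_le; lra|left; apply exp_pos].
Qed.

Lemma damped_response_derive (n : nat) (h : R -> R) (t : R) : (1 <= n)%nat ->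
  (forall x, continuity_pt h x) -> 0 < t ->
  is_derive (damped_response n h) t (h t - damping n t * damped_response n h t).
Proof.
  intros Hn Hh Ht. assert (Hq := integrating_factor_pos n t Ht).
  assert (Hcont : forall x, continuous (fun s => integrating_factor n s * h s) x).
  { intros x. apply continuity_pt_filterlim, continuity_pt_mul;
      [apply integrating_factor_continuity|apply Hh]. }
  apply is_derive_ext_loc with
    (fun x => / integrating_factor n x * RInt (fun s => integrating_factor n s * h s) 0 x).
  - exists (mkposreal t Ht). intros x Hx.
    apply (Rabs_lt_between' x t t) in Hx. unfold damped_response. destruct (Rle_dec x 0); lra.
  - evar_last.
    + apply @is_derive_mult; [| |exact Rmult_comm].
      * apply is_derive_inv; [now apply integrating_factor_derive|lra].
      * apply is_derive_RInt with 0; [|apply Hcont].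
        exists posreal_one. intros b _. apply @RInt_correct, ex_RInt_continuous.
        intros x _. apply Hcont.
    + unfold damped_response. destruct (Rle_dec t 0); [lra|].
      unfold plus, mult; simpl. field. lra.
Qed.

Lemma damped_response_continuity (n : nat) (h : R -> R) (M t : R) : (1 <= n)%nat ->
  (forall x, continuity_pt h x) -> (forall x, Rabs (h x) <= M) ->
  continuity_pt (damped_response n h) t.
Proof.
  intros Hn Hh HM. assert (HM0 := HM 0). assert (Hh0 := Rabs_pos (h 0)).
  destruct (Rlt_dec 0 t) as [Ht|Ht].
  - eapply is_derive_continuity_pt. now apply damped_response_derive.
  - intros e He. exists (e / (M + 1)). split; [apply Rdiv_lt_0_compat; lra|].
    intros x [_ Hx]. rewrite (damped_response_npos n h t) by lra.
    unfold dist in *; simpl in *; unfold Rdist in *. rewrite Rminus_0_r.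
    apply Rle_lt_trans with (1 := damped_response_bound n h M x Hh HM).
    apply Rabs_def2 in Hx.
    replace e with ((M + 1) * (e / (M + 1))) by (field; lra).
    assert (0 <= Rmax 0 x < e / (M + 1)).
    { split; [apply Rmax_l|]. apply Rmax_lub_lt; [apply Rdiv_lt_0_compat; lra|lra]. }
    nra.
Qed.

(* Successive stages of Tonelli's scheme with delay [tau]: stage [j] is final on [t <= j tau]. *)
Fixpoint delayed_stage (n : nat) (h : R -> R) (tau alpha : R) (j : nat) (t : R) : R :=
  match j with
  | O => alpha
  | S i => alpha
      + RInt (damped_response n (fun s => h (delayed_stage n h tau alpha i (s - tau)))) 0 t
  end.

Definition delayed_slope (n : nat) (h : R -> R) (tau alpha : R) (j : nat) : R -> R :=
  damped_response n (fun s => h (delayed_stage n h tau alpha j (s - tau))).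

(** The two claims feed each other: a continuous forcing makes the next stage differentiable, which
    makes the next forcing continuous. The bound [M] enters through the continuity of the response
    at 0. *)
Lemma delayed_stage_derive (n : nat) (h : R -> R) (M tau alpha : R) (j : nat) : (1 <= n)%nat ->
  (forall x, continuity_pt h x) -> (forall x, Rabs (h x) <= M) ->
  (forall x, continuity_pt (fun s => h (delayed_stage n h tau alpha j (s - tau))) x) /\
  (forall x, is_derive (delayed_stage n h tau alpha (S j)) x (delayed_slope n h tau alpha j x)).
Proof.
  intros Hn Hh HM.
  assert (Hshift : forall f x, (forall y, continuity_pt f y) ->
    continuity_pt (fun s => h (f (s - tau))) x).
  { intros f x Hf. apply (continuity_pt_compose (fun s => f (s - tau))); [|apply Hh].
    apply (continuity_pt_compose (fun s => s - tau)); [repeat continuity_step|apply Hf]. }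
  assert (Hstep : forall i,
    (forall x, continuity_pt (fun s => h (delayed_stage n h tau alpha i (s - tau))) x) ->
    forall x, is_derive (delayed_stage n h tau alpha (S i)) x (delayed_slope n h tau alpha i x)).
  { intros i Hi x. simpl. evar_last.
    - apply @is_derive_plus; [apply @is_derive_const|].
      assert (Hc : forall b, continuous (delayed_slope n h tau alpha i) b).
      { intros b. apply continuity_pt_filterlim.
        apply damped_response_continuity with M; auto. }
      apply (is_derive_RInt (delayed_slope n h tau alpha i)) with 0; [|apply Hc].
      exists posreal_one. intros b _. apply @RInt_correct, ex_RInt_continuous.
      intros y _. apply Hc.
    - unfold plus, zero; simpl. ring. }
  split; [|apply Hstep]; induction j as [|j IH].
  - intros x. apply (Hshift (fun _ => alpha)). intros y. apply continuity_pt_cst.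
  - intros x. apply (Hshift (delayed_stage n h tau alpha (S j))). intros y.
    eapply is_derive_continuity_pt. now apply Hstep.
  - intros x. apply (Hshift (fun _ => alpha)). intros y. apply continuity_pt_cst.
  - intros x. apply (Hshift (delayed_stage n h tau alpha (S j))). intros y.
    eapply is_derive_continuity_pt. now apply Hstep.
Qed.

Lemma damped_response_ext (n : nat) (f g : R -> R) (t : R) :
  (forall s, s <= t -> f s = g s) -> damped_response n f t = damped_response n g t.
Proof.
  intros Hfg. unfold damped_response. destruct (Rle_dec t 0) as [|Ht]; [reflexivity|].
  f_equal. apply RInt_ext. intros s Hs.
  rewrite Rmin_left, Rmax_right in Hs by lra. now rewrite Hfg by lra.
Qed.

Lemma delayed_stage_npos (n : nat) (h : R -> R) (tau alpha : R) (j : nat) (t : R) :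
  t <= 0 -> delayed_stage n h tau alpha j t = alpha.
Proof.
  intros Ht. destruct j as [|j]; [reflexivity|]. simpl.
  rewrite (RInt_ext _ (fun _ => 0)).
  - rewrite RInt_const. unfold scal; simpl; unfold mult; simpl. ring.
  - intros s Hs. rewrite Rmax_left in Hs by lra. apply damped_response_npos. lra.
Qed.

(** Method of steps: up to time (j+1) tau a stage sees the preceding one only up to time j tau,
    where that one is already final. *)
Lemma delayed_stage_stable (n : nat) (h : R -> R) (tau alpha : R) (j : nat) (t : R) :
  0 < tau -> t <= INR j * tau ->
  delayed_stage n h tau alpha (S j) t = delayed_stage n h tau alpha j t.
Proof.
  intros Htau. revert t. induction j as [|j IH]; intros t Ht.
  - rewrite Rmult_0_l in Ht. now rewrite !delayed_stage_npos.
  - change (delayed_stage n h tau alpha (S (S j)) t) with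
      (alpha + RInt (delayed_slope n h tau alpha (S j)) 0 t).
    change (delayed_stage n h tau alpha (S j) t) with
      (alpha + RInt (delayed_slope n h tau alpha j) 0 t).
    f_equal. apply RInt_ext. intros s Hs. apply damped_response_ext. intros x Hx.
    f_equal. apply IH. rewrite S_INR in Ht.
    destruct (Rle_dec 0 t) as [Ht0|Ht0].
    + rewrite Rmax_right in Hs by lra. lra.
    + rewrite Rmax_left in Hs by lra. assert (0 <= INR j * tau).
      { apply Rmult_le_pos; [apply pos_INR|lra]. } lra.
Qed.

(** The forcing [g] is kept apart from [h (w k)]: the linear equation for [y k] holds exactly with
    [g], and the nonlinear one only in the limit, uniformly on bounded time intervals. *)
Definition approximations (n : nat) (h : R -> R) (alpha : R) (w y g : nat -> R -> R) : Prop :=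
  (forall k t, is_derive (w k) t (y k t)) /\ (forall k t, continuity_pt (y k) t) /\
  (forall k t, t <= 0 -> w k t = alpha /\ y k t = 0) /\
  (forall k t, 0 < t -> is_derive (y k) t (g k t - damping n t * y k t)) /\
  forall d T, 0 < d -> exists N, forall k t, (N <= k)%nat -> 0 < t < T ->
    Rabs (g k t - h (w k t)) <= d.

Lemma approximations_exist (n : nat) (h : R -> R) (M alpha : R) : (1 <= n)%nat ->
  (forall x, Rabs (h x) <= M) ->
  (forall e, 0 < e -> exists d, 0 < d /\ forall x z, Rabs (x - z) <= d -> Rabs (h x - h z) <= e) ->
  exists w y g, approximations n h alpha w y g.
Proof.
  intros Hn HM Hu. assert (HM0 := HM 0). assert (Hh0 := Rabs_pos (h 0)).
  assert (Hh : forall x, continuity_pt h x).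
  { intros x e He. destruct (Hu (e / 2) ltac:(lra)) as [d [Hd Hde]].
    exists d. split; [assumption|]. intros z [_ Hz].
    apply Rle_lt_trans with (e / 2); [|lra]. apply Hde. left. exact Hz. }
  (* The delay 1/(k+1) tends to 0 while (k+1)^2 stages reach the time k+1, which tends to infinity;
     hence any [0, T] is eventually covered. *)
  set (tau := fun k => / INR (S k)). set (J := fun k => (S k * S k)%nat).
  assert (HSk : forall k, 0 < INR (S k)) by (intros k; apply lt_0_INR; lia).
  assert (Htau : forall k, 0 < tau k) by (intros k; now apply Rinv_0_lt_compat).
  exists (fun k => delayed_stage n h (tau k) alpha (S (J k))),
    (fun k => delayed_slope n h (tau k) alpha (J k)),
    (fun k t => h (delayed_stage n h (tau k) alpha (J k) (t - tau k))).
  assert (Hd : forall k t, is_derive (delayed_stage n h (tau k) alpha (S (J k))) t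
    (delayed_slope n h (tau k) alpha (J k) t)).
  { intros k. now apply delayed_stage_derive with M. }
  assert (Hc : forall k x, continuity_pt
    (fun s => h (delayed_stage n h (tau k) alpha (J k) (s - tau k))) x).
  { intros k. now apply delayed_stage_derive with M. }
  split; [assumption|]. split; [|split; [|split]].
  - intros k t. apply damped_response_continuity with M; auto.
  - intros k t Ht. split; [now apply delayed_stage_npos|now apply damped_response_npos].
  - intros k t Ht. apply (damped_response_derive n _ t Hn (Hc k) Ht).
  - intros d T Hd0. destruct (Hu d Hd0) as [e [He Hed]].
    destruct (INR_unbounded (Rmax T (M * Rmax 0 T / e))) as [N HN].
    exists N. intros k t Hk Ht. apply Hed.
    assert (HkN : INR N < INR (S k)) by (apply lt_INR; lia).
    assert (HTk := Rmax_l T (M * Rmax 0 T / e)). assert (HMk := Rmax_r T (M * Rmax 0 T / e)).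
    assert (Htk : INR (S k) * tau k = 1) by (unfold tau; field; apply Rgt_not_eq, HSk).
    (* At time [t - tau k] the stages [J k] and [S (J k)] agree, so the defect compares one function
       at two times [tau k] apart; its slope is at most M max(0, T). *)
    rewrite <- delayed_stage_stable; [|apply Htau|].
    + destruct (MVT_abs (delayed_stage n h (tau k) alpha (S (J k)))
        (delayed_slope n h (tau k) alpha (J k)) t (t - tau k)) as [c [Heq Hct]].
      { intros x _. apply is_derive_Reals, Hd. }
      rewrite Heq. replace (t - tau k - t) with (- tau k) by ring.
      specialize (Htau k). rewrite Rabs_Ropp, (Rabs_pos_eq (tau k)) by lra.
      rewrite Rmax_left in Hct by lra.
      assert (Hs := damped_response_bound n _ M c (Hc k) (fun x => HM _)).
      fold (delayed_slope n h (tau k) alpha (J k)) in Hs.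
      assert (HcT : Rmax 0 c <= Rmax 0 T) by (apply Rle_max_compat_l; lra).
      apply Rle_trans with (M * Rmax 0 T * tau k).
      * apply Rmult_le_compat_r; [lra|]. apply Rle_trans with (1 := Hs).
        apply Rmult_le_compat_l; lra.
      * apply Rle_trans with (INR (S k) * e * tau k).
        -- apply Rmult_le_compat_r; [lra|].
           apply Rmult_le_reg_r with (/ e); [now apply Rinv_0_lt_compat|].
           replace (INR (S k) * e * / e) with (INR (S k)) by (field; lra). unfold Rdiv in *. lra.
        -- right. rewrite <- (Rmult_1_l e) at 2. rewrite <- Htk. ring.
    + unfold J. rewrite mult_INR. specialize (Htau k).
      replace (INR (S k) * INR (S k) * tau k) with (INR (S k))
        by (rewrite Rmult_assoc, Htk; ring). lra.
Qed.

(** Uniformity holds on half-lines (-oo, T], since the approximations are constant for t <= 0. Every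
    ball is then covered, including those around 0. *)
Definition unif_lim (u : nat -> R -> R) (f : R -> R) : Prop :=
  forall T e, 0 < e -> exists N, forall k t, (N <= k)%nat -> t <= T -> Rabs (u k t - f t) <= e.

Lemma unif_lim_of_cauchy (u : nat -> R -> R) :
  (forall T e, 0 < e -> exists N, forall k l t, (N <= k)%nat -> (N <= l)%nat -> t <= T ->
    Rabs (u k t - u l t) <= e) ->
  exists f, unif_lim u f.
Proof.
  intros Hu. exists (fun t => real (Lim_seq (fun k => u k t))).
  intros T e He. destruct (Hu T (e / 2) ltac:(lra)) as [N HN].
  exists N. intros k t Hk Ht.
  assert (Hlim : is_lim_seq (fun k => u k t) (Finite (real (Lim_seq (fun k => u k t))))).
  { apply Lim_seq_correct', ex_lim_seq_cauchy_corr. intros d.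
    assert (Hd := cond_pos d).
    destruct (Hu t (d / 2) ltac:(lra)) as [N' HN']. exists N'. intros i j Hi Hj.
    specialize (HN' i j t Hi Hj ltac:(lra)). lra. }
  apply is_lim_seq_spec in Hlim.
  destruct (Hlim (mkposreal (e / 2) ltac:(lra))) as [N' HN']. simpl in HN'.
  specialize (HN' (max N N') ltac:(lia)).
  specialize (HN k (max N N') t Hk ltac:(lia) Ht).
  apply Rabs_le_between in HN. apply Rabs_def2 in HN'. apply Rabs_le. lra.
Qed.

Lemma unif_lim_CVU (u : nat -> R -> R) (f : R -> R) (c : R) (r : posreal) :
  unif_lim u f -> CVU u f c r.
Proof.
  intros Hu e He. destruct (Hu (c + r) (e / 2) ltac:(lra)) as [N HN].
  exists N. intros k t Hk Ht. apply Rabs_def2 in Ht.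
  rewrite Rabs_minus_sym. specialize (HN k t Hk ltac:(lra)). lra.
Qed.

Lemma unif_lim_continuity (u : nat -> R -> R) (f : R -> R) (t : R) :
  unif_lim u f -> (forall k t, continuity_pt (u k) t) -> continuity_pt f t.
Proof.
  intros Hu Hc.
  apply (CVU_continuity u f t posreal_one); [now apply unif_lim_CVU|now intros k s _|].
  unfold Boule. rewrite Rminus_diag, Rabs_R0. apply cond_pos.
Qed.

Lemma unif_lim_Un_cv (u : nat -> R -> R) (f : R -> R) (t : R) :
  unif_lim u f -> Un_cv (fun k => u k t) (f t).
Proof.
  intros Hu e He. destruct (Hu t (e / 2) ltac:(lra)) as [N HN]. exists N. intros k Hk.
  unfold Rdist. specialize (HN k t Hk ltac:(lra)). lra.
Qed.

Lemma limit_solves (n : nat) (h : R -> R) (alpha : R) (w y g : nat -> R -> R) (w0 y0 : R -> R) :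
  (1 <= n)%nat ->
  (forall e, 0 < e -> exists d, 0 < d /\ forall x z, Rabs (x - z) <= d -> Rabs (h x - h z) <= e) ->
  approximations n h alpha w y g -> unif_lim w w0 -> unif_lim y y0 ->
  w0 0 = alpha /\ forall T, almost_solves n h 0 T w0 y0.
Proof.
  intros Hn Hu [Hw [Hyc [H0 [Hy Hg]]]] Hw0 Hy0. assert (HN := INR_ge_1 n Hn).
  assert (Hself : forall t (r : posreal), Boule t r t).
  { intros t r. unfold Boule. rewrite Rminus_diag, Rabs_R0. apply cond_pos. }
  assert (Hwd : forall t, is_derive w0 t (y0 t)).
  { intros t. apply is_derive_Reals.
    apply (CVU_derivable w y w0 y0 t posreal_one); [now apply unif_lim_CVU| | |apply Hself].
    - intros x _. now apply unif_lim_Un_cv.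
    - intros k x _. apply is_derive_Reals, Hw. }
  assert (Hval : forall (u : nat -> R -> R) f l, unif_lim u f -> (forall k, u k 0 = l) -> f 0 = l).
  { intros u f l Huf Hul. apply (UL_sequence (fun k => u k 0)); [now apply unif_lim_Un_cv|].
    intros e He. exists O. intros k _. now rewrite Hul, Rdist_eq. }
  split; [apply (Hval w); [assumption|intros k; now apply H0]|].
  intros T. split; [|split; [|split]].
  - intros t. eapply is_derive_continuity_pt, Hwd.
  - intros t. now apply unif_lim_continuity with y.
  - apply (Hval y); [assumption|intros k; now apply H0].
  - intros t Ht. split; [apply Hwd|]. exists 0. split; [rewrite Rabs_R0; lra|].
    rewrite Rplus_0_r. apply is_derive_Reals.
    (* The derivatives of [y] converge uniformly only away from the pole of the damping. On the ball
       of radius t/2 around t the damping is at most 2n/t + t, the constant [b] below. *)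
    assert (Ht2 : 0 < t / 2) by lra.
    apply (CVU_derivable y (fun k s => g k s - damping n s * y k s) y0
      (fun s => h (w0 s) - damping n s * y0 s) t (mkposreal _ Ht2)); [| | |apply Hself].
    + intros e He.
      set (b := 2 * INR n / t + t).
      assert (Hb : 0 < b).
      { unfold b. assert (0 < 2 * INR n / t) by (apply Rdiv_lt_0_compat; lra). lra. }
      destruct (Hg (e / 6) (2 * t) ltac:(lra)) as [N1 HN1].
      destruct (Hu (e / 6) ltac:(lra)) as [d [Hd Hde]].
      destruct (Hw0 (2 * t) d Hd) as [N2 HN2].
      destruct (Hy0 (2 * t) (e / (6 * b))) as [N3 HN3]; [apply Rdiv_lt_0_compat; lra|].
      exists (max N1 (max N2 N3)). intros k s Hk Hs.
      apply Rabs_def2 in Hs. simpl in Hs.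
      specialize (HN1 k s ltac:(lia) ltac:(lra)). specialize (HN2 k s ltac:(lia) ltac:(lra)).
      specialize (HN3 k s ltac:(lia) ltac:(lra)). specialize (Hde _ _ HN2).
      assert (Hdb : 0 <= damping n s <= b).
      { assert (Hd0 := damping_ge_half n s Hn ltac:(lra)). split; [lra|].
        unfold damping, b. apply Rplus_le_compat; [|lra].
        apply Rle_trans with (INR n / s).
        - apply Rmult_le_compat_r; [left; apply Rinv_0_lt_compat; lra|lra].
        - replace (2 * INR n / t) with (INR n * / (t / 2)) by (field; lra).
          apply Rmult_le_compat_l; [lra|]. apply Rinv_le_contravar; lra. }
      assert (Hdy : Rabs (damping n s * (y k s - y0 s)) <= e / 6).
      { rewrite Rabs_mult, (Rabs_pos_eq (damping n s)) by lra.
        replace (e / 6) with (b * (e / (6 * b))) by (field; lra).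
        apply Rmult_le_compat; try apply Rabs_pos; lra. }
      apply Rabs_le_between in HN1. apply Rabs_le_between in Hde.
      apply Rabs_le_between in Hdy. apply Rabs_def1; lra.
    + intros x _. now apply unif_lim_Un_cv.
    + intros k x Hx. apply Rabs_def2 in Hx. simpl in Hx.
      apply is_derive_Reals, Hy. lra.
Qed.

(** Energy barrier: initial potential plus drift stays below the potential at [a]. The truncated
    potential increases with |w| without restriction, so no first exit time has to be considered. *)
Lemma truncated_solution_bound (n : nat) (p a d T Y : R) (w y : R -> R) : (1 <= n)%nat ->
  0 < p < 1 -> 0 < a < alpha_max p -> almost_solves n (truncated p a) d T w y ->
  (forall x, 0 <= x <= T -> Rabs (y x) <= Y) -> 0 <= d -> 0 <= Y ->
  potential (truncated p a) (w 0) + d * (Y * T) < potential (truncated p a) a ->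
  forall t, 0 <= t <= T -> Rabs (w t) <= a.
Proof.
  intros Hn Hp Ha Hs HY Hd HY0 HV t Ht.
  assert (HE := energy_almost_decreasing n _ d T (d * Y) w y 0 t Hn
    (fun x => truncated_continuity p a x Hp) Hs
    (fun x Hx => Rmult_le_compat_l d _ _ Hd (HY x Hx)) ltac:(lra) ltac:(lra) ltac:(lra)).
  destruct Hs as [_ [_ [Hy0 _]]]. unfold energy in HE. rewrite Hy0 in HE.
  destruct (Rle_dec (Rabs (w t)) a) as [|Hwa]; [assumption|].
  assert (Hlt := truncated_potential_lt p a a (w t) Hp Ha).
  rewrite (Rabs_pos_eq a) in Hlt by lra. specialize (Hlt ltac:(lra)).
  assert (d * Y * (t - 0) <= d * (Y * T)).
  { rewrite Rmult_assoc. repeat apply Rmult_le_compat_l; lra. }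
  assert (0 <= y t * y t) by apply Rle_0_sqr. lra.
Qed.

Lemma truncated_solution_exists (n : nat) (p a alpha : R) : (1 <= n)%nat ->
  0 < p < 1 -> 0 < a < alpha_max p -> 0 <= alpha < a ->
  exists w y, w 0 = alpha /\ forall T, almost_solves n (truncated p a) 0 T w y.
Proof.
  intros Hn Hp Ha Halpha.
  destruct (truncated_bounded p a Hp ltac:(lra)) as [M [HM0 HM]].
  assert (Hu := fun e => truncated_uniform_continuity p a e Hp).
  destruct (approximations_exist n (truncated p a) M alpha Hn HM Hu) as [w [y [g Happ]]].
  assert (Halmost : forall d T, 0 < d -> exists N, forall k, (N <= k)%nat ->
    almost_solves n (truncated p a) d T (w k) (y k)).
  { intros d T Hd. destruct Happ as [Hw [Hyc [H0 [Hy Hg]]]].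
    destruct (Hg d T Hd) as [N HN]. exists N. intros k Hk.
    split; [|split; [|split]].
    - intros t. eapply is_derive_continuity_pt, Hw.
    - apply Hyc.
    - now apply H0.
    - intros t Ht. split; [apply Hw|]. exists (g k t - truncated p a (w k t)).
      split; [now apply HN|]. evar_last; [apply Hy; lra|]. ring. }
  assert (Hcauchy : forall T e, 0 < e -> exists N, forall k l t, (N <= k)%nat -> (N <= l)%nat ->
    t <= T -> Rabs (w k t - w l t) <= e /\ Rabs (y k t - y l t) <= e).
  { intros T e He.
    assert (HT : 0 <= Rmax 0 T) by apply Rmax_l. assert (HTT := Rmax_r 0 T).
    set (T' := Rmax 0 T) in *. clearbody T'.
    destruct (comparison n p a T' e Hn Hp Ha HT He) as [d [Hd Hcomp]].
    set (Y := (M + 1) * T').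
    assert (HY : 0 <= Y) by (apply Rmult_le_pos; lra).
    assert (HV : potential (truncated p a) alpha < potential (truncated p a) a).
    { apply truncated_potential_lt; try assumption. rewrite !Rabs_pos_eq; lra. }
    (* The comparison requires its first argument to stay in [-a, a]; the defect [d'] is small
       enough that its energy drift does not use up this gap. *)
    set (gap := potential (truncated p a) a - potential (truncated p a) alpha).
    assert (Hgap : 0 < gap) by (unfold gap; lra).
    assert (HYT : 0 <= Y * T') by now apply Rmult_le_pos.
    assert (Hq : 0 < gap / (Y * T' + 1)) by (apply Rdiv_lt_0_compat; lra).
    assert (Hd' : exists d', 0 < d' <= d /\ d' * (Y * T') < gap).
    { exists (Rmin d (gap / (Y * T' + 1))).
      assert (H1 := Rmin_l d (gap / (Y * T' + 1))).
      assert (H2 := Rmin_r d (gap / (Y * T' + 1))).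
      assert (H3 : 0 < Rmin d (gap / (Y * T' + 1))) by (apply Rmin_glb_lt; lra).
      repeat split; try assumption.
      apply Rle_lt_trans with (gap / (Y * T' + 1) * (Y * T')).
      - apply Rmult_le_compat_r; lra.
      - replace gap with (gap / (Y * T' + 1) * (Y * T' + 1)) at 2 by (field; lra).
        apply Rmult_lt_compat_l; lra. }
    destruct Hd' as [d' [Hd' Hd'gap]].
    destruct (Halmost d' T' ltac:(lra)) as [N HN]. exists N. intros k l t Hk Hl Ht.
    destruct Happ as [_ [_ [H0 _]]].
    destruct (Rle_dec t 0) as [Ht0|Ht0].
    - destruct (H0 k t Ht0) as [-> ->]. destruct (H0 l t Ht0) as [-> ->].
      rewrite !Rminus_diag, Rabs_R0. lra.
    - assert (Hweak : forall i, (N <= i)%nat -> almost_solves n (truncated p a) d T' (w i) (y i)).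
      { intros i Hi. apply almost_solves_weaken with d'; [lra|now apply HN]. }
      apply Hcomp; [now apply Hweak|now apply Hweak| | |lra].
      + destruct (H0 k 0 ltac:(lra)) as [-> _]. destruct (H0 l 0 ltac:(lra)) as [-> _].
        rewrite Rminus_diag, Rabs_R0. lra.
      + apply (truncated_solution_bound n p a d' T' Y (w k) (y k)); try assumption; try lra.
        * now apply HN.
        * intros s Hs.
          apply Rle_trans with (1 := almost_solves_bound n _ M d T' _ _ Hn HM ltac:(lra)
            (Hweak k Hk) s Hs).
          apply Rmult_le_compat; lra.
        * destruct (H0 k 0 ltac:(lra)) as [-> _]. unfold gap in Hd'gap. lra. }
  destruct (unif_lim_of_cauchy w) as [w0 Hw0].
  { intros T e He. destruct (Hcauchy T e He) as [N HN]. exists N.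
    intros k l t Hk Hl Ht. now apply HN. }
  destruct (unif_lim_of_cauchy y) as [y0 Hy0].
  { intros T e He. destruct (Hcauchy T e He) as [N HN]. exists N.
    intros k l t Hk Hl Ht. now apply HN. }
  exists w0, y0. now apply (limit_solves n _ alpha w y g).
Qed.

(** * Decay at infinity *)

Lemma exact_energy_decreasing (n : nat) (h w y : R -> R) (s t : R) :
  (1 <= n)%nat -> (forall x, continuity_pt h x) -> (forall T, almost_solves n h 0 T w y) ->
  0 <= s <= t -> energy h w y t <= energy h w y s.
Proof.
  intros Hn Hh Hsol Hst.
  assert (HE := energy_almost_decreasing n h 0 t 0 w y s t Hn Hh (Hsol t)).
  assert (Hx : forall x, 0 <= x <= t -> 0 * Rabs (y x) <= 0) by (intros; lra).
  specialize (HE Hx ltac:(lra) ltac:(lra) ltac:(lra)). lra.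
Qed.

(* With [c] from [w H(w) <= - c w^2] and [A] large, [G = A E + w^2/4 + w w'/t] satisfies
   [G' <= - (w'^2 + c w^2 / 2) / t]: the damping controls only [w'], and the term [w w'/t] brings in
   the decay of [w]. *)
Lemma lyapunov_derive (n : nat) (p a c t : R) (w y : R -> R) :
  (1 <= n)%nat -> 0 < p < 1 -> 0 < c -> 1 <= t ->
  w t * truncated p a (w t) <= - c * (w t * w t) ->
  is_derive w t (y t) -> is_derive y t (truncated p a (w t) - damping n t * y t) ->
  exists l, is_derive (fun s => (4 + INR n * INR n / c) * energy (truncated p a) w y s
      + w s * w s / 4 + w s * y s / s) t l /\
    l <= - (y t * y t + c / 2 * (w t * w t)) / t.
Proof.
  intros Hn Hp Hc Ht Hh Hw Hy.
  assert (HE : is_derive (energy (truncated p a) w y) t (y t * 0 - damping n t * (y t * y t))).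
  { apply energy_derive; [intros x; now apply truncated_continuity|assumption|].
    evar_last; [exact Hy|ring]. }
  assert (HN := INR_ge_1 n Hn).
  set (A := 4 + INR n * INR n / c) in *. set (h := truncated p a (w t)) in *.
  (* The part t/2 of the damping contributes -wy/2 to the derivative of wy/t, and the derivative of
     w^2/4 cancels it. The part (n-1)/t and the derivative of 1/t combine to -n wy/t^2. *)
  exists (- A * damping n t * (y t * y t)
    + (y t * y t + w t * h - INR n * (w t * y t / t)) / t). split.
  - evar_last.
    + apply @is_derive_plus; [apply @is_derive_plus|].
      * apply is_derive_scal, HE.
      * apply (is_derive_ext (fun s => / 4 * (w s * w s))); [intros s; simpl; field|].
        apply is_derive_scal, @is_derive_mult; [exact Hw|exact Hw|exact Rmult_comm].
      * apply @is_derive_mult; [|apply is_derive_inv; [apply is_derive_id|lra]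
          |exact Rmult_comm].
        apply @is_derive_mult; [exact Hw|exact Hy|exact Rmult_comm].
    + unfold plus, mult, one; simpl. unfold plus, mult; simpl. unfold damping. field. lra.
  - assert (Hb := damping_ge_half n t Hn ltac:(lra)).
    assert (Hit : 0 < / t <= 1).
    { split; [apply Rinv_0_lt_compat; lra|]. rewrite <- Rinv_1. apply Rinv_le_contravar; lra. }
    assert (Hbt : / t / 2 <= damping n t) by lra.
    assert (HA : 4 <= A).
    { unfold A. assert (0 <= INR n * INR n / c) by (apply Rdiv_le_0_compat; nra). lra. }
    (* Young's inequality spends half of the gain c w^2 on the cross term. Its other half, n^2
       y^2/(2c), and a further 2 y^2 are covered by A/2 = 2 + n^2/(2c), since the damping is at
       least 1/(2t) for t >= 1. *)
    assert (Hcross : - (INR n * (w t * y t / t))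
                     <= c / 2 * (w t * w t) + INR n * INR n / (2 * c) * (y t * y t)).
    { assert (Hsq := Rle_0_sqr (c * w t + INR n * (y t / t))). unfold Rsqr in Hsq.
      assert (Hyt : y t / t * (y t / t) <= y t * y t).
      { unfold Rdiv. assert (/ t * / t <= 1) by nra.
        assert (0 <= y t * y t) by apply Rle_0_sqr. nra. }
      assert (HNy : INR n * INR n * (y t / t * (y t / t)) <= INR n * INR n * (y t * y t))
        by (apply Rmult_le_compat_l; nra).
      apply Rmult_le_reg_l with (2 * c); [lra|].
      replace (2 * c * (c / 2 * (w t * w t) + INR n * INR n / (2 * c) * (y t * y t)))
        with (c * w t * (c * w t) + INR n * INR n * (y t * y t)) by (field; lra).
      replace (2 * c * - (INR n * (w t * y t / t)))
        with (- (2 * (c * w t) * (INR n * (y t / t)))) by (field; lra).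
      lra. }
    assert (Hy2 : 0 <= y t * y t) by apply Rle_0_sqr.
    assert (HAd : A * (/ t / 2) * (y t * y t) <= A * damping n t * (y t * y t)).
    { apply Rmult_le_compat_r; [assumption|]. apply Rmult_le_compat_l; lra. }
    replace (A * (/ t / 2) * (y t * y t))
      with ((2 * (y t * y t) + INR n * INR n / (2 * c) * (y t * y t)) / t) in HAd
      by (unfold A; field; lra).
    apply Rle_trans with ((- (2 * (y t * y t) + INR n * INR n / (2 * c) * (y t * y t))
      + (y t * y t + w t * h - INR n * (w t * y t / t))) / t).
    + unfold Rdiv in *. lra.
    + apply Rmult_le_compat_r; lra.
Qed.

Lemma exact_derive (n : nat) (h w y : R -> R) : (forall T, almost_solves n h 0 T w y) ->
  forall t, 0 < t -> is_derive w t (y t) /\ is_derive y t (h (w t) - damping n t * y t).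
Proof.
  intros Hsol t Ht. destruct (Hsol (t + 1)) as [_ [_ [_ Hd]]].
  destruct (Hd t ltac:(lra)) as [Hw [r [Hr Hy]]]. split; [assumption|].
  evar_last; [exact Hy|]. apply Rabs_le_between in Hr. assert (r = 0) by lra. subst r. ring.
Qed.

(** If the energy is still at least [e] at a late time, it was so at all earlier times, and [G] then
    decreases at rate at least kappa/t from t = 1 on. The logarithmic loss contradicts the lower
    bound -aM of [G], which holds because |y| <= M t. *)
Lemma energy_vanishes (n : nat) (p a : R) (w y : R -> R) (e : R) :
  (1 <= n)%nat -> 0 < p < 1 -> 0 < a < alpha_max p ->
  (forall T, almost_solves n (truncated p a) 0 T w y) ->
  (forall t, 0 <= t -> Rabs (w t) <= a) -> 0 < e ->
  exists t, 0 <= t /\ energy (truncated p a) w y t < e.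
Proof.
  intros Hn Hp Ha Hsol Hwa He.
  destruct (truncated_bounded p a Hp ltac:(lra)) as [M [HM0 HM]].
  assert (Hg := Rpower_gt_below_alpha_max p a Hp Ha).
  set (c := Rpower a (p - 1) - / (1 - p)). assert (Hc : 0 < c) by (unfold c; lra).
  set (e' := e / (2 * M)). assert (He' : 0 < e') by (apply Rdiv_lt_0_compat; lra).
  (* [kappa] bounds y^2 + (c/2) w^2 from below while the energy is at least [e]: either y^2 >= e, or
     the potential exceeds e/2 and then |w| >= [e']. *)
  assert (Hkappa : exists kappa, 0 < kappa /\ kappa <= e /\ kappa <= c / 2 * (e' * e')).
  { exists (Rmin e (c / 2 * (e' * e'))). repeat split; [|apply Rmin_l|apply Rmin_r].
    apply Rmin_glb_lt; [assumption|]. apply Rmult_lt_0_compat; [lra|now apply Rmult_lt_0_compat]. }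
  destruct Hkappa as [kappa [Hk [Hke Hkc]]].
  set (G := fun s => (4 + INR n * INR n / c) * energy (truncated p a) w y s
      + w s * w s / 4 + w s * y s / s).
  (* At time exp X the loss kappa ln t exceeds by 1 the largest possible drop |G(1)| + aM. *)
  set (X := (Rabs (G 1) + a * M + 1) / kappa).
  assert (HX : 0 < X).
  { assert (0 <= Rabs (G 1)) by apply Rabs_pos.
    assert (0 < a * M) by (apply Rmult_lt_0_compat; lra).
    apply Rdiv_lt_0_compat; lra. }
  assert (HeX : 1 < exp X) by (rewrite <- exp_0; now apply exp_increasing).
  exists (exp X). split; [lra|].
  apply Rnot_le_lt. intros HE.
  assert (Hmono : G (exp X) + kappa * ln (exp X) <= G 1 + kappa * ln 1).
  { assert (HG : forall t, 1 <= t -> exists l, is_derive G t l /\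
      l <= - (y t * y t + c / 2 * (w t * w t)) / t).
    { intros t Ht. destruct (exact_derive n _ w y Hsol t ltac:(lra)) as [Hw Hy].
      apply (lyapunov_derive n p a c t w y); try assumption.
      assert (Hwt := Hwa t ltac:(lra)). rewrite truncated_id by assumption.
      now apply H_neg_quadratic. }
    apply (nonincreasing_of_derive (fun t => G t + kappa * ln t)); [lra| |].
    - intros t Ht. destruct (HG t ltac:(lra)) as [l [Hl _]]. repeat continuity_step.
      + now apply is_derive_continuity_pt with l.
      + eapply is_derive_continuity_pt, is_derive_ln. lra.
    - intros t Ht. destruct (HG t ltac:(lra)) as [l [Hl Hle]].
      exists (l + kappa * / t). split.
      + apply @is_derive_plus; [exact Hl|]. apply is_derive_scal, is_derive_ln. lra.
      + assert (Hit : 0 < / t) by (apply Rinv_0_lt_compat; lra).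
        enough (kappa <= y t * y t + c / 2 * (w t * w t)) by (unfold Rdiv in Hle; nra).
        assert (HEt : e <= energy (truncated p a) w y t).
        { apply Rle_trans with (1 := HE).
          apply (exact_energy_decreasing n); try assumption; [|lra].
          intros x. now apply truncated_continuity. }
        assert (Hw2 : 0 <= c / 2 * (w t * w t))
          by (apply Rmult_le_pos; [lra|apply Rle_0_sqr]).
        assert (Hy2 : 0 <= y t * y t) by apply Rle_0_sqr.
        destruct (Rle_dec e (y t * y t)) as [|Hey]; [lra|].
        unfold energy in HEt.
        assert (HV := potential_lipschitz (truncated p a) M (w t) 0
          (fun x => truncated_continuity p a x Hp) HM).
        rewrite potential_0, !Rminus_0_r in HV.
        assert (HV' := Rle_abs (potential (truncated p a) (w t))).
        assert (Hew : e' <= Rabs (w t)).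
        { apply Rmult_le_reg_l with M; [lra|].
          replace (M * e') with (e / 2) by (unfold e'; field; lra). lra. }
        assert (e' * e' <= w t * w t).
        { replace (w t * w t) with (Rabs (w t) * Rabs (w t))
            by (rewrite <- Rabs_mult; apply Rabs_pos_eq, Rle_0_sqr).
          apply Rmult_le_compat; lra. }
        assert (c / 2 * (e' * e') <= c / 2 * (w t * w t)) by (apply Rmult_le_compat_l; lra).
        lra. }
  assert (HGlow : - (a * M) <= G (exp X)).
  { unfold G. set (t := exp X) in *.
    assert (HEnn : 0 <= energy (truncated p a) w y t) by lra.
    assert (0 <= INR n * INR n / c) by (apply Rdiv_le_0_compat; [apply Rle_0_sqr|assumption]).
    assert (0 <= (4 + INR n * INR n / c) * energy (truncated p a) w y t)
      by (apply Rmult_le_pos; lra).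
    assert (0 <= w t * w t) by apply Rle_0_sqr.
    assert (Hwy : Rabs (w t * y t / t) <= a * M).
    { unfold Rdiv. rewrite Rmult_assoc, Rabs_mult.
      apply Rmult_le_compat; try apply Rabs_pos; [apply Hwa; lra|].
      assert (Hyb := almost_solves_bound n _ M 0 t w y Hn HM ltac:(lra) (Hsol t) t ltac:(lra)).
      rewrite Rabs_mult, (Rabs_pos_eq (/ t)) by (left; apply Rinv_0_lt_compat; lra).
      apply Rmult_le_reg_r with t; [lra|]. rewrite Rmult_assoc, Rinv_l by lra. lra. }
    apply Rabs_le_between in Hwy. lra. }
  rewrite ln_exp, ln_1 in Hmono.
  replace (kappa * X) with (Rabs (G 1) + a * M + 1) in Hmono by (unfold X; field; lra).
  assert (HG1 := Rle_abs (G 1)). lra.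
Qed.

Lemma truncated_solution_decays (n : nat) (p a : R) (w y : R -> R) :
  (1 <= n)%nat -> 0 < p < 1 -> 0 < a < alpha_max p ->
  (forall T, almost_solves n (truncated p a) 0 T w y) ->
  (forall t, 0 <= t -> Rabs (w t) <= a) ->
  is_lim w p_infty 0 /\ is_lim y p_infty 0.
Proof.
  intros Hn Hp Ha Hsol Hwa.
  assert (Hsmall : forall eta, 0 < eta -> exists T, forall t, T < t ->
    Rabs (w t) <= eta /\ Rabs (y t) <= eta).
  { intros eta Heta. destruct (small_of_small_energy p a eta Hp Ha Heta) as [e [He Hs]].
    destruct (energy_vanishes n p a w y e Hn Hp Ha Hsol Hwa He) as [T [HT HET]].
    exists T. intros t Ht. apply Hs.
    assert (HE := exact_energy_decreasing n (truncated p a) w y T t Hn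
      (fun x => truncated_continuity p a x Hp) Hsol ltac:(lra)). lra. }
  split; apply is_lim_spec; intros eps; assert (Heps := cond_pos eps);
    destruct (Hsmall (eps / 2) ltac:(lra)) as [T HT]; exists T; intros t Ht;
    rewrite Rminus_0_r; destruct (HT t Ht); lra.
Qed.

(** * Solutions of (P) *)

(** With c = h(w(0)), the line c t/n solves y' = c - (n-1) y/t. The remainder y - c t/n obeys the
    damped equation with forcing h(w) - c - c t^2/(2n), small near 0, and is therefore at most e t.
    This yields w''(0) = c/n. *)
Lemma slope_at_0 (n : nat) (h w y : R -> R) (e : R) :
  (1 <= n)%nat -> (forall x, continuity_pt h x) -> (forall T, almost_solves n h 0 T w y) ->
  0 < e -> exists d, 0 < d /\ forall t, 0 < t < d ->
    Rabs (h (w t) - h (w 0)) <= e /\ Rabs (y t / t - h (w 0) / INR n) <= e.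
Proof.
  intros Hn Hh Hsol He. assert (HN := INR_ge_1 n Hn).
  set (c := h (w 0)). destruct (Hsol 1) as [Hw [Hy [Hy0 _]]].
  assert (Hhw : continuity_pt (fun t => h (w t)) 0) by (apply continuity_pt_compose; auto).
  destruct (Hhw (e / 2) ltac:(lra)) as [d0 [Hd0 Hd]].
  assert (Hc : 0 < e / (Rabs c + 1)).
  { assert (H1 := Rabs_pos c). apply Rdiv_lt_0_compat; lra. }
  set (d := Rmin d0 (Rmin 1 (e / (Rabs c + 1)))).
  assert (Hdpos : 0 < d) by (repeat apply Rmin_glb_lt; lra).
  assert (Hdd0 : d <= d0) by apply Rmin_l.
  assert (Hd1 : d <= 1) by (apply Rle_trans with (1 := Rmin_r _ _), Rmin_l).
  assert (Hdc : d <= e / (Rabs c + 1)) by (apply Rle_trans with (1 := Rmin_r _ _), Rmin_r).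
  clearbody d.
  assert (Hclose : forall t, 0 < t < d -> Rabs (h (w t) - c) <= e / 2).
  { intros t Ht. left. apply (Hd t). split; [split; [exact I|lra]|].
    simpl. unfold Rdist. rewrite Rminus_0_r, Rabs_pos_eq; lra. }
  exists d. split; [assumption|]. intros t Ht. split; [specialize (Hclose t Ht); lra|].
  assert (Hbound : Rabs (y t - c / INR n * t) <= e * t).
  { apply (damped_bound n e d (fun s => y s - c / INR n * s)); try assumption; try lra.
    - intros s. repeat continuity_step. apply Hy.
    - intros s Hs. exists (h (w s) - c - c * (s * s) / (2 * INR n)). split.
      + assert (Hcs : Rabs (c * (s * s) / (2 * INR n)) <= e / 2).
        { unfold Rdiv. rewrite Rmult_assoc, Rabs_mult, (Rabs_pos_eq (s * s * _)).
          - assert (Hss : s * s * / (2 * INR n) <= d * / 2).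
            { apply Rmult_le_compat; [nra|left; apply Rinv_0_lt_compat; lra|nra|].
              apply Rinv_le_contravar; lra. }
            assert (Hce : Rabs c * d <= e).
            { assert (H1 := Rabs_pos c).
              apply Rle_trans with ((Rabs c + 1) * (e / (Rabs c + 1))); [|right; field; lra].
              apply Rmult_le_compat; lra. }
            apply Rle_trans with (Rabs c * (d * / 2)); [|lra].
            apply Rmult_le_compat_l; [apply Rabs_pos|assumption].
          - apply Rmult_le_pos; [nra|left; apply Rinv_0_lt_compat; lra]. }
        specialize (Hclose s Hs). apply Rabs_le_between in Hcs.
        apply Rabs_le_between in Hclose. apply Rabs_le. lra.
      + evar_last.
        * apply @is_derive_minus; [apply (exact_derive n h w y Hsol s); lra|].
          auto_derive; [trivial|reflexivity].
        * unfold minus, plus, opp; simpl. unfold damping. fold c. field. lra. }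
  replace (y t / t - c / INR n) with ((y t - c / INR n * t) * / t) by (field; lra).
  rewrite Rabs_mult, (Rabs_pos_eq (/ t)) by (left; apply Rinv_0_lt_compat; lra).
  apply Rmult_le_reg_r with t; [lra|]. rewrite Rmult_assoc, Rinv_l by lra. lra.
Qed.

Lemma is_derive_D_in (f df : R -> R) (D : R -> Prop) (t : R) :
  is_derive f t (df t) -> D_in f df D t.
Proof.
  intros Hf. apply D_in_imp with no_cond; [now intros|].
  now apply derivable_pt_lim_D_in, is_derive_Reals.
Qed.

Lemma is_solution_of_truncated (n : nat) (p a alpha : R) (w y : R -> R) :
  (1 <= n)%nat -> 0 < p < 1 -> w 0 = alpha ->
  (forall T, almost_solves n (truncated p a) 0 T w y) ->
  (forall t, 0 <= t -> Rabs (w t) <= a) ->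
  is_solution n p alpha w y.
Proof.
  intros Hn Hp Hw0 Hsol Hwa. assert (HN := INR_ge_1 n Hn).
  assert (Hcont : forall x, continuity_pt (truncated p a) x)
    by (intros x; now apply truncated_continuity).
  assert (Hder := exact_derive n _ w y Hsol).
  destruct (Hsol 1) as [Hw [Hy [Hy0 _]]].
  set (h0 := truncated p a (w 0)).
  (* At 0 the equation is singular; the value is its limit h0 - (n-1) h0/n, because y/t tends to
     h0/n. *)
  set (ddw := fun t => if Rle_dec t 0 then h0 / INR n
                       else truncated p a (w t) - damping n t * y t).
  assert (Hddw : forall t, 0 < t -> ddw t = truncated p a (w t) - damping n t * y t).
  { intros t Ht. unfold ddw. destruct (Rle_dec t 0); lra. }
  assert (Hddw0 : ddw 0 = h0 / INR n) by (unfold ddw; destruct (Rle_dec 0 0); lra).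
  exists ddw. split; [|split; [|split; [|split; [|split; [|split]]]]]; try assumption.
  - intros t Ht. destruct (Rle_lt_or_eq_dec 0 t Ht) as [Ht0|<-].
    + now apply is_derive_D_in, Hder.
    + intros e He. destruct (Hy 0 e He) as [d [Hd Hde]]. exists d. split; [assumption|].
      intros x [[Hx Hx0] Hxd]. unfold Defs.nonneg in Hx. simpl in *.
      (* The one-sided difference quotient at 0 is [y c] with 0 <= c <= x, and [y] is continuous at
         0. *)
      destruct (MVT_gen w 0 x y) as [c [Hc Heq]].
      * rewrite Rmin_left, Rmax_right by lra. intros s Hs. apply Hder; lra.
      * intros s _. apply Hw.
      * rewrite Rmin_left, Rmax_right in Hc by lra. rewrite Heq.
        replace (y c * (x - 0) / (x - 0)) with (y c) by (field; lra).
        destruct (Req_dec c 0) as [->|Hc0]; [now rewrite Rdist_eq|].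
        apply Hde. split; [split; [exact I|lra]|]. unfold Rdist in *.
        rewrite Rminus_0_r in *. rewrite Rabs_pos_eq in * by lra. lra.
  - intros t Ht. destruct (Rle_lt_or_eq_dec 0 t Ht) as [Ht0|<-].
    + apply is_derive_D_in. rewrite Hddw by assumption. now apply Hder.
    + intros e He.
      destruct (slope_at_0 n _ w y (e / 2) Hn Hcont Hsol) as [d [Hd Hde]]; [lra|].
      exists d. split; [assumption|]. intros x [[Hx Hx0] Hxd]. unfold Defs.nonneg in Hx.
      simpl in *. unfold Rdist in *. rewrite Rminus_0_r, Rabs_pos_eq in Hxd by lra.
      rewrite Hddw0, Hy0, !Rminus_0_r. destruct (Hde x ltac:(lra)) as [_ Hs].
      fold h0 in Hs. lra.
  - intros t Ht. destruct (Rle_lt_or_eq_dec 0 t Ht) as [Ht0|<-].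
    + apply limit1_imp with (D_x no_cond t); [intros x [_ Hx]; now split|].
      apply (continuity_pt_locally_ext (fun s => truncated p a (w s) - damping n s * y s) ddw t t
        Ht0).
      * intros s Hs. apply Rabs_def2 in Hs. symmetry. apply Hddw. lra.
      * repeat continuity_step; [now apply continuity_pt_compose| |apply Hy].
        eapply is_derive_continuity_pt. unfold damping. auto_derive; [lra|reflexivity].
    + intros e He. set (e' := e / (2 * (INR n + 1))).
      assert (He' : 0 < e') by (apply Rdiv_lt_0_compat; lra).
      assert (Hee' : 2 * (INR n * e') < e).
      { replace e with (2 * (INR n + 1) * e') by (unfold e'; field; lra). nra. }
      destruct (slope_at_0 n _ w y e' Hn Hcont Hsol He') as [d [Hd Hde]].
      destruct (Hy 0 e' He') as [d2 [Hd2 Hde2]].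
      exists (Rmin d (Rmin d2 1)). split; [repeat apply Rmin_glb_lt; lra|].
      intros x [[Hx Hx0] Hxd]. unfold Defs.nonneg in Hx. simpl in *. unfold Rdist in *.
      rewrite Rminus_0_r, Rabs_pos_eq in Hxd by lra.
      assert (Hxd1 : x < d) by (apply Rlt_le_trans with (1 := Hxd), Rmin_l).
      assert (Hxd2 : x < d2)
        by (apply Rlt_le_trans with (1 := Hxd), Rle_trans with (1 := Rmin_r _ _), Rmin_l).
      assert (Hx1 : x < 1)
        by (apply Rlt_le_trans with (1 := Hxd), Rle_trans with (1 := Rmin_r _ _), Rmin_r).
      destruct (Hde x ltac:(lra)) as [Hh Hs]. fold h0 in Hh, Hs.
      assert (Hyx : Rabs (y x - y 0) < e').
      { apply Hde2. split; [split; [exact I|lra]|]. rewrite Rminus_0_r, Rabs_pos_eq; lra. }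
      rewrite Hy0, Rminus_0_r in Hyx.
      rewrite Hddw0, Hddw by lra.
      (* Grouping the pole with y/x leaves three small errors, of sizes e', (n-1) e' and e'/2; their
         sum is at most 2 n e' < e. *)
      replace (truncated p a (w x) - damping n x * y x - h0 / INR n)
        with (truncated p a (w x) - h0 - (INR n - 1) * (y x / x - h0 / INR n) - x * y x / 2)
        by (unfold damping; field; lra).
      apply Rabs_le_between in Hh. apply Rabs_le_between in Hs. apply Rabs_def2 in Hyx.
      apply Rabs_def1; nra.
  - now exists a.
  - intros t Ht. rewrite Hddw by assumption.
    rewrite <- (truncated_id p a (w t)) by (apply Hwa; lra). unfold damping. ring.
Qed.

(** Composition with max(0, .) replaces one-sided notions by ordinary ones through a constant
    extension to the left. For the slope it may create a kink at 0, which is harmless since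
    derivatives are used only for t > 0. *)
Lemma continuity_pt_extend (f df : R -> R) : deriv_nonneg f df ->
  forall t, continuity_pt (fun s => f (Rmax 0 s)) t.
Proof.
  intros Hf t e He.
  destruct (cont_deriv _ _ _ _ (Hf (Rmax 0 t) (Rmax_l 0 t)) e He) as [d [Hd Hde]].
  exists d. split; [assumption|]. intros x [_ Hx]. simpl in *.
  destruct (Req_dec (Rmax 0 x) (Rmax 0 t)) as [->|Hne]; [now rewrite Rdist_eq|].
  apply Hde. split; [split; [apply Rmax_l|congruence]|].
  apply Rle_lt_trans with (2 := Hx). unfold Rdist, Rmax.
  destruct (Rle_dec 0 x), (Rle_dec 0 t); unfold Rabs; repeat destruct Rcase_abs; lra.
Qed.

Lemma is_derive_extend (f df : R -> R) (t : R) : deriv_nonneg f df -> 0 < t ->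
  is_derive (fun s => f (Rmax 0 s)) t (df t).
Proof.
  intros Hf Ht. apply is_derive_Reals. intros e He.
  destruct (Hf t (Rlt_le _ _ Ht) e He) as [d [Hd Hde]].
  assert (Hm : 0 < Rmin d t) by now apply Rmin_glb_lt.
  exists (mkposreal _ Hm). simpl. intros x Hx0 Hx.
  assert (H1 := Rmin_l d t). assert (H2 := Rmin_r d t).
  assert (Hx' := Rabs_def2 _ _ Hx). rewrite !Rmax_right by lra.
  specialize (Hde (t + x)). simpl in Hde. unfold Rdist in Hde.
  replace (t + x - t) with x in Hde by ring.
  apply Hde. split; [split; [unfold Defs.nonneg; lra|lra]|lra].
Qed.

(** The energy of the untruncated equation confines an arbitrary solution to [-a, a], where [H] and
    its truncation agree; uniqueness can thus be proved for the truncated equation. *)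
Lemma truncated_of_is_solution (n : nat) (p a alpha : R) (v dv : R -> R) :
  (1 <= n)%nat -> 0 < p < 1 -> 0 < a < alpha_max p -> 0 <= alpha < a ->
  is_solution n p alpha v dv ->
  forall T, almost_solves n (truncated p a) 0 T (fun t => v (Rmax 0 t)) (fun t => dv (Rmax 0 t)).
Proof.
  intros Hn Hp Ha Halpha [ddv [Hv [Hdv [_ [_ [Hv0 [Hdv0 Hode]]]]]]].
  set (w := fun t => v (Rmax 0 t)). set (y := fun t => dv (Rmax 0 t)).
  assert (Hw : forall t, continuity_pt w t) by now apply continuity_pt_extend with dv.
  assert (Hy : forall t, continuity_pt y t) by now apply continuity_pt_extend with ddv.
  assert (Hcont : forall x, continuity_pt (H p) x) by (intros x; now apply H_continuity).
  assert (Hy0 : y 0 = 0) by (unfold y; now rewrite Rmax_left by lra).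
  assert (Hsol : forall T, almost_solves n (H p) 0 T w y).
  { intros T. split; [assumption|]. split; [assumption|]. split; [assumption|].
    intros t Ht. assert (Hmax : Rmax 0 t = t) by (apply Rmax_right; lra). split.
    - unfold y. rewrite Hmax. apply is_derive_extend; [assumption|lra].
    - exists 0. split; [rewrite Rabs_R0; lra|]. evar_last.
      + apply is_derive_extend; [exact Hdv|lra].
      + unfold w, y, damping. rewrite Hmax. specialize (Hode t ltac:(lra)). lra. }
  assert (Hwa : forall t, 0 <= t -> Rabs (w t) <= a).
  { intros t Ht. destruct (Rle_dec (Rabs (w t)) a) as [|Hlt]; [assumption|].
    assert (Hw0 : w 0 = alpha) by (unfold w; now rewrite Rmax_left by lra).
    (* The potential of [H] itself is known to increase only up to [alpha_max], so the energy is
       evaluated at a time when |w| equals [a] exactly, not at [t]. *)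
    destruct (IVT_cor (fun s => Rabs (w s) - a) 0 t) as [s [Hs Hws]].
    - intros s. apply continuity_pt_sub; [|apply continuity_pt_cst].
      apply (continuity_pt_compose w); [apply Hw|apply Rcontinuity_abs].
    - lra.
    - rewrite Hw0, (Rabs_pos_eq alpha) by lra. nra.
    - assert (HE := exact_energy_decreasing n (H p) w y 0 s Hn Hcont Hsol ltac:(lra)).
      unfold energy in HE. rewrite Hy0, Hw0 in HE.
      rewrite <- (potential_abs (H p) (w s) Hcont (H_opp p)) in HE.
      replace (Rabs (w s)) with a in HE by lra.
      assert (potential (H p) alpha < potential (H p) a).
      { apply potential_increasing; [assumption|lra|]. intros x Hx. apply H_neg; [assumption|lra]. }
      assert (0 <= y s * y s) by apply Rle_0_sqr. lra. }
  intros T. destruct (Hsol T) as [_ [_ [_ Hd]]].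
  split; [assumption|]. split; [assumption|]. split; [assumption|].
  intros t Ht. rewrite truncated_id by (apply Hwa; lra). now apply Hd.
Qed.

Lemma truncated_solution_le (n : nat) (p a : R) (w y : R -> R) : (1 <= n)%nat ->
  0 < p < 1 -> 0 < a < alpha_max p -> 0 <= w 0 < a ->
  (forall T, almost_solves n (truncated p a) 0 T w y) ->
  forall t, 0 <= t -> Rabs (w t) <= a.
Proof.
  intros Hn Hp Ha Hw0 Hsol t Ht.
  destruct (truncated_bounded p a Hp ltac:(lra)) as [M [HM0 HM]].
  apply (truncated_solution_bound n p a 0 t (M * t) w y); try assumption; try lra; try nra.
  - apply Hsol.
  - intros x Hx.
    apply Rle_trans with (1 := almost_solves_bound n _ M 0 t w y Hn HM ltac:(lra) (Hsol t) x Hx).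
    rewrite Rplus_0_r. apply Rmult_le_compat_l; lra.
  - rewrite Rmult_0_l, Rplus_0_r. apply truncated_potential_lt; try assumption.
    rewrite !Rabs_pos_eq; lra.
Qed.

Lemma truncated_solution_unique (n : nat) (p a : R) (w1 y1 w2 y2 : R -> R) : (1 <= n)%nat ->
  0 < p < 1 -> 0 < a < alpha_max p -> 0 <= w1 0 < a -> w1 0 = w2 0 ->
  (forall T, almost_solves n (truncated p a) 0 T w1 y1) ->
  (forall T, almost_solves n (truncated p a) 0 T w2 y2) ->
  forall t, 0 <= t -> w1 t = w2 t.
Proof.
  intros Hn Hp Ha Hw1 Hw12 Hs1 Hs2 t Ht.
  destruct (Req_dec (w1 t) (w2 t)) as [|Hne]; [assumption|].
  assert (Hpos : 0 < Rabs (w1 t - w2 t)) by (apply Rabs_pos_lt; lra).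
  destruct (comparison n p a t (Rabs (w1 t - w2 t) / 2) Hn Hp Ha Ht) as [d [Hd Hcomp]]; [lra|].
  destruct (Hcomp w1 y1 w2 y2) with t as [Hz _]; try lra.
  - apply almost_solves_weaken with 0; [lra|apply Hs1].
  - apply almost_solves_weaken with 0; [lra|apply Hs2].
  - rewrite Hw12, Rminus_diag, Rabs_R0. lra.
  - intros s Hs. apply (truncated_solution_le n p a w1 y1); try assumption. lra.
Qed.

(** The truncated equation is part of the conclusion, with [a] prescribed, so that solutions with
    different initial values can be compared under one truncation. *)
Lemma unique_solution_exists (n : nat) (p a alpha : R) : (1 <= n)%nat ->
  0 < p < 1 -> 0 < a < alpha_max p -> 0 <= alpha < a ->
  exists w y, is_unique_solution n p alpha w y /\ (is_lim w p_infty 0 /\ is_lim y p_infty 0) /\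
    w 0 = alpha /\ (forall T, almost_solves n (truncated p a) 0 T w y).
Proof.
  intros Hn Hp Ha Halpha.
  destruct (truncated_solution_exists n p a alpha Hn Hp Ha Halpha) as [w [y [Hw0 Hsol]]].
  assert (Hwa : forall t, 0 <= t -> Rabs (w t) <= a).
  { apply (truncated_solution_le n p a w y); try assumption. lra. }
  exists w, y. split; [split|split; [|now split]].
  - now apply is_solution_of_truncated with a.
  - intros v dv Hv t Ht. unfold Defs.nonneg in Ht.
    assert (Hvt := truncated_of_is_solution n p a alpha v dv Hn Hp Ha Halpha Hv).
    destruct Hv as [ddv [_ [_ [_ [_ [Hv0 _]]]]]].
    rewrite <- (Rmax_right 0 t) at 1 by assumption.
    apply (truncated_solution_unique n p a (fun s => v (Rmax 0 s)) (fun s => dv (Rmax 0 s)) w y);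
      try assumption; rewrite Rmax_left; lra.
  - now apply truncated_solution_decays with n p a.
Qed.

Theorem theorem3p14 (n : nat) (p alpha1 : R)
    (hn : (1 <= n)%nat) (hp : 0 < p < 1)
    (halpha1 : 0 <= alpha1 < alpha_max p) :
  exists w1 dw1 : R -> R,
    is_unique_solution n p alpha1 w1 dw1 /\
    (is_lim w1 p_infty 0 /\ is_lim dw1 p_infty 0) /\
    forall eps : R, 0 < eps ->
      exists delta : R, 0 < delta /\
        forall alpha2 : R, 0 <= alpha2 < alpha_max p ->
          Rabs (alpha1 - alpha2) < delta ->
          exists w2 dw2 : R -> R,
            is_unique_solution n p alpha2 w2 dw2 /\
            (forall eta : R, 0 <= eta ->
               Rmax (Rabs (w1 eta - w2 eta)) (Rabs (dw1 eta - dw2 eta)) < eps) /\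
            (is_lim w2 p_infty 0 /\ is_lim dw2 p_infty 0).
Proof.
  (* One truncation level strictly between [alpha1] and [alpha_max p] serves every [alpha2] closer
     to [alpha1] than a - alpha1. *)
  set (a := (alpha1 + alpha_max p) / 2).
  assert (Ha : 0 < a < alpha_max p) by (unfold a; lra).
  assert (Halpha1 : 0 <= alpha1 < a) by (unfold a; lra).
  clearbody a.
  assert (Hcont : forall x, continuity_pt (truncated p a) x)
    by (intros x; now apply truncated_continuity).
  destruct (unique_solution_exists n p a alpha1 hn hp Ha Halpha1)
    as [w1 [y1 [Hu1 [Hl1 [Hw1 Hs1]]]]].
  exists w1, y1. split; [assumption|]. split; [assumption|].
  assert (Hwa : forall t, 0 <= t -> Rabs (w1 t) <= a).
  { apply (truncated_solution_le n p a w1 y1); try assumption. lra. }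
  intros eps Heps.
  destruct (truncated_bounded p a hp ltac:(lra)) as [M [HM0 HM]].
  destruct (small_of_small_energy p a (eps / 4) hp Ha ltac:(lra)) as [e [He Hsmall]].
  (* [T] depends on [w1] alone. Energies do not increase, so once that of [w2] at [T] is known to be
     at most 2e, both solutions and both slopes stay within eps/4 of 0 after [T], and comparison is
     needed only on [0, T]. *)
  destruct (energy_vanishes n p a w1 y1 e hn hp Ha Hs1 Hwa He) as [T [HT HE1]].
  assert (HMT : 0 <= M * T) by (apply Rmult_le_pos; lra).
  assert (Hq : 0 < e / (M * T + M)) by (apply Rdiv_lt_0_compat; lra).
  (* Solutions that are [mu]-close at time [T] have energies there differing by at most [e], the
     slopes being bounded by M T. *)
  assert (Hmu : exists mu, 0 < mu <= eps / 2 /\ (M * T + M) * mu <= e).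
  { exists (Rmin (eps / 2) (e / (M * T + M))).
    assert (H1 := Rmin_l (eps / 2) (e / (M * T + M))).
    assert (H2 := Rmin_r (eps / 2) (e / (M * T + M))).
    repeat split; [apply Rmin_glb_lt; lra|assumption|].
    replace e with ((M * T + M) * (e / (M * T + M))) at 2 by (field; lra).
    apply Rmult_le_compat_l; lra. }
  destruct Hmu as [mu [Hmu HmuE]].
  destruct (comparison n p a T mu hn hp Ha HT ltac:(lra)) as [d [Hd Hcomp]].
  exists (Rmin d (a - alpha1)). split; [apply Rmin_glb_lt; lra|].
  intros alpha2 Halpha2 Hclose.
  assert (Hcd : Rabs (alpha1 - alpha2) < d) by (apply Rlt_le_trans with (1 := Hclose), Rmin_l).
  assert (Hca : Rabs (alpha1 - alpha2) < a - alpha1)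
    by (apply Rlt_le_trans with (1 := Hclose), Rmin_r).
  apply Rabs_def2 in Hca.
  destruct (unique_solution_exists n p a alpha2 hn hp Ha ltac:(lra))
    as [w2 [y2 [Hu2 [Hl2 [Hw2 Hs2]]]]].
  exists w2, y2. split; [assumption|]. split; [|assumption].
  assert (HcompT : forall t, 0 <= t <= T ->
    Rabs (w1 t - w2 t) <= mu /\ Rabs (y1 t - y2 t) <= mu).
  { apply Hcomp.
    - apply almost_solves_weaken with 0; [lra|apply Hs1].
    - apply almost_solves_weaken with 0; [lra|apply Hs2].
    - rewrite Hw1, Hw2. lra.
    - intros t Ht. apply Hwa; lra. }
  assert (HE2 : energy (truncated p a) w2 y2 T <= 2 * e).
  { destruct (HcompT T ltac:(lra)) as [Hz Hx].
    assert (HyT : forall w y, (forall T, almost_solves n (truncated p a) 0 T w y) ->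
      Rabs (y T) <= M * T).
    { intros w y Hs.
      apply Rle_trans with (1 := almost_solves_bound n _ M 0 T w y hn HM ltac:(lra) (Hs T) T
        ltac:(lra)). lra. }
    assert (Hdiff := energy_diff_le (truncated p a) M (M * T) w1 y1 w2 y2 T Hcont HM
      (HyT w1 y1 Hs1) (HyT w2 y2 Hs2)).
    assert (M * T * Rabs (y1 T - y2 T) <= M * T * mu) by (apply Rmult_le_compat_l; lra).
    assert (M * Rabs (w1 T - w2 T) <= M * mu) by (apply Rmult_le_compat_l; lra).
    apply Rabs_le_between in Hdiff. lra. }
  intros t Ht. apply Rmax_lub_lt; destruct (Rle_dec t T) as [HtT|HtT];
    try (destruct (HcompT t ltac:(lra)); lra);
    assert (HEt1 := exact_energy_decreasing n _ w1 y1 T t hn Hcont Hs1 ltac:(lra));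
    assert (HEt2 := exact_energy_decreasing n _ w2 y2 T t hn Hcont Hs2 ltac:(lra));
    destruct (Hsmall w1 y1 t ltac:(lra)) as [Hw1t Hy1t];
    destruct (Hsmall w2 y2 t ltac:(lra)) as [Hw2t Hy2t];
    apply Rabs_le_between in Hw1t; apply Rabs_le_between in Hw2t;
    apply Rabs_le_between in Hy1t; apply Rabs_le_between in Hy2t;
    apply Rabs_def1; lra.
Qed.
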